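(* Let $A$ be an abelian group with finite torsion-free rank. Then the set $UI(A)$ of uniform inertial endomorphisms of $A$ is a subring of $E(A)$ containing $F(A)$, where: i) $UI(A)/F(A)$ is isomorphic to a subring of $\mathcal H(A)$; ii) if $A$ is periodic, then $UI(A)=FM(A)=M(A)+F(A)$ and $UI(A)/F(A)\simeq\mathcal H(A)$; iii) there exists a periodic quotient $\bar A$ of $A$ such that $UI(\bar A)/F(\bar A)\simeq\mathcal H(A)$.
   Context: All groups are abelian, written additively. $E(A)$ is the endomorphism ring of $A$; ''periodic'' means torsion; the torsion-free rank of $A$ is the rank of $A/T(A)$, with $T(A)$ the torsion subgroup. $\varphi\in E(A)$ is inertial if $H$ has finite index in $H+\varphi(H)$ for every subgroup $H\le A$. $F(A)$ is the ideal of finitary endomorphisms, i.e. those with finite image. $Q_p^*$ is the ring of $p$-adic integers and $\mathcal J=\prod_pQ_p^*$ (product over all primes), acting componentwise on every periodic abelian group. For $A$ periodic, $M(A)$ is the ring of multiplications of $A$, i.e. the endomorphisms given by the action of elements of $\mathcal J$, and $FM(A)$ is the ring of endomorphisms $\varphi$ which leave invariant some finite index subgroup $A_0$ of $A$ and act on it by an element of $M(A_0)$ (equivalently, act by a multiplication modulo some finite invariant subgroup). An inertial endomorphism $\varphi$ of $A$ is uniform if there are $\varphi$-invariant subgroups $F\le A_0\le A$ such that $A/A_0$ is finite, $A_0/F$ is periodic and $\varphi$ acts on $A_0/F$ as multiplication by some $\alpha\in\mathcal J$, and $F$ is free abelian with $\varphi=0$ on $F$. The ring $\mathcal H(A)$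 (for $A$ of finite torsion-free rank): fix a free abelian subgroup $F\le A$ with $A/F$ periodic. For each prime $p$ let $p^{e_p}$ be the bound (least annihilating positive integer) of the $p$-component $(A/F)_p$ if this is bounded, and $e_p=\infty$ otherwise; let $\epsilon_p$ be the smallest $\epsilon$ such that $p^{\epsilon}(A/F)_p$ is finite if $(A/F)_p$ is bounded, and $\epsilon_p=\infty$ otherwise. Let $(p^x)$ be the ideal of $Q_p^*$ generated by $p^x$, with $p^\infty:=0$. Then $$\mathcal H(A):=\frac{\prod_pQ_p^*/(p^{e_p})}{\bigoplus_p(p^{\epsilon_p})/(p^{e_p})}\simeq\frac{\prod_pQ_p^*}{\bigoplus_p(p^{\epsilon_p})+\prod_p(p^{e_p})},$$ which does not depend on the choice of $F$. Isomorphisms are ring isomorphisms; sums are sums in the additive group of $E(A)$. *)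

(* Defs.v *)
From HB Require Import structures.
From mathcomp Require Import all_boot all_order all_algebra.
From mathcomp Require Import generic_quotient ring_quotient.
From mathcomp Require Import boolp classical_sets functions cardinality.

Set Implicit Arguments.
Unset Strict Implicit.
Unset Printing Implicit Defensive.

Import GRing.Theory.

Local Open Scope ring_scope.
Local Open Scope quotient_scope.
Local Open Scope classical_set_scope.

(* An abelian group is a zmodType A and a subgroup of A is a term of type
   zmodClosed A: membership predicates are boolean, but classically every
   subgroup is of this form. The factor group A/K is {quot K}. *)

Notation "{ 'quot' I }" := (@Quotient.quot _ I) : type_scope.

(* The ideals of ring_quotient are proper ideals of nonzero commutative rings.
   Here the factor rings may be zero (e.g. E(A)/F(A) for A finite) and E(A) is
   not commutative. *)
HB.mixin Record isTwoSidedIdeal (R : pzRingType) (I : R -> bool) := {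
  ideal_mull : forall a x, x \in I -> a * x \in I;
  ideal_mulr : forall a x, x \in I -> x * a \in I
}.

#[short(type="twoSidedIdeal")]
HB.structure Definition TwoSidedIdeal (R : pzRingType) :=
  {I of GRing.ZmodClosed R I & isTwoSidedIdeal R I}.

Definition factor_ring (R : pzRingType) (I : twoSidedIdeal R) := {quot I}.

Section FactorRing.
Variables (R : pzRingType) (I : twoSidedIdeal R).
Local Notation Q := (factor_ring I).

HB.instance Definition _ := GRing.Zmodule.copy Q {quot I}.

Definition factor_pi (x : R) : Q := \pi_({quot I}) x.
Definition factor_one : Q := factor_pi 1.
Definition factor_mul (x y : Q) : Q := factor_pi (repr x * repr y).

Lemma factor_piP x y : reflect (factor_pi x = factor_pi y) (x - y \in I).
Proof. by rewrite Quotient.idealrBE; apply: eqP. Qed.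

Lemma factor_reprK (x : Q) : factor_pi (repr x) = x.
Proof. exact: reprK. Qed.

Lemma factor_piD x y : factor_pi (x + y) = factor_pi x + factor_pi y.
Proof. exact: (raddfD (\pi_({quot I}))). Qed.

Lemma factor_piM x y : factor_pi (x * y) = factor_mul (factor_pi x) (factor_pi y).
Proof.
have hx : x - repr (factor_pi x) \in I.
  by apply/factor_piP; rewrite factor_reprK.
have hy : y - repr (factor_pi y) \in I.
  by apply/factor_piP; rewrite factor_reprK.
apply/factor_piP; set x' := repr _ in hx *; set y' := repr _ in hy *.
have -> : x * y - x' * y' = (x - x') * y + x' * (y - y').
  by rewrite mulrBl mulrBr addrA subrK.
by apply: rpredD; [apply: ideal_mulr | apply: ideal_mull].
Qed.

Fact factor_mulA : associative factor_mul.
Proof.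
move=> x y z; rewrite -[x]factor_reprK -[y]factor_reprK -[z]factor_reprK.
by rewrite -!factor_piM mulrA.
Qed.

Fact factor_mul1 : left_id factor_one factor_mul.
Proof. by move=> x; rewrite -[x]factor_reprK -factor_piM mul1r. Qed.

Fact factor_mulr1 : right_id factor_one factor_mul.
Proof. by move=> x; rewrite -[x]factor_reprK -factor_piM mulr1. Qed.

Fact factor_mulDl : left_distributive factor_mul +%R.
Proof.
move=> x y z; rewrite -[x]factor_reprK -[y]factor_reprK -[z]factor_reprK.
by rewrite -factor_piD -!factor_piM mulrDl factor_piD.
Qed.

Fact factor_mulDr : right_distributive factor_mul +%R.
Proof.
move=> x y z; rewrite -[x]factor_reprK -[y]factor_reprK -[z]factor_reprK.
by rewrite -factor_piD -!factor_piM mulrDr factor_piD.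
Qed.

HB.instance Definition _ := GRing.Zmodule_isPzRing.Build Q
  factor_mulA factor_mul1 factor_mulr1 factor_mulDl factor_mulDr.

End FactorRing.

(* Image in R/J of the ideal I of R: this is I/J when J is contained in I. *)
Definition in_image_ideal (R : pzRingType) (J I : twoSidedIdeal R) :
    factor_ring J -> bool :=
  fun x => `[< exists2 y, y \in I & x = factor_pi J y >].
Arguments in_image_ideal {R} J I x.

Section ImageIdeal.
Variables (R : pzRingType) (J I : twoSidedIdeal R).

Fact image_ideal_zmod : zmod_closed (in_image_ideal J I).
Proof.
split.
  apply/asboolP; exists 0; first exact: rpred0.
  exact: esym (raddf0 (\pi_({quot J}))).
move=> _ _ /asboolP[x xI ->] /asboolP[y yI ->]; apply/asboolP.
exists (x - y); first by rewrite rpredB.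
exact: esym (raddfB (\pi_({quot J})) x y).
Qed.

HB.instance Definition _ :=
  GRing.isZmodClosed.Build (factor_ring J) (in_image_ideal J I) image_ideal_zmod.

Fact image_ideal_mull a x :
  x \in in_image_ideal J I -> a * x \in in_image_ideal J I.
Proof.
move=> /asboolP[y yI ->]; apply/asboolP; exists (repr a * y).
  exact: ideal_mull.
by rewrite factor_piM factor_reprK.
Qed.

Fact image_ideal_mulr a x :
  x \in in_image_ideal J I -> x * a \in in_image_ideal J I.
Proof.
move=> /asboolP[y yI ->]; apply/asboolP; exists (y * repr a).
  exact: ideal_mulr.
by rewrite factor_piM factor_reprK.
Qed.

HB.instance Definition _ := isTwoSidedIdeal.Build (factor_ring J)
  (in_image_ideal J I) image_ideal_mull image_ideal_mulr.

Definition image_ideal : twoSidedIdeal (factor_ring J) :=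
  TwoSidedIdeal.clone _ (in_image_ideal J I) _.

End ImageIdeal.

Definition prod_ring (I : Type) (R : I -> pzRingType) := forall i, R i.

Section ProdRing.
Variables (I : Type) (R : I -> pzRingType).
Local Notation P := (prod_ring R).

HB.instance Definition _ := Choice.copy P (forall i, R i).

Fact prod_addA : associative (fun x y : P => (fun i => x i + y i) : P).
Proof. by move=> x y z; apply: functional_extensionality_dep => i; rewrite addrA. Qed.
Fact prod_addC : commutative (fun x y : P => (fun i => x i + y i) : P).
Proof. by move=> x y; apply: functional_extensionality_dep => i; rewrite addrC. Qed.
Fact prod_add0 :
  left_id ((fun i => 0) : P) (fun x y : P => (fun i => x i + y i) : P).
Proof. by move=> x; apply: functional_extensionality_dep => i; rewrite add0r. Qed.
Fact prod_addN : left_inverse ((fun i => 0) : P) (fun x : P => (fun i => - x i) : P)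
  (fun x y : P => (fun i => x i + y i) : P).
Proof. by move=> x; apply: functional_extensionality_dep => i; rewrite addNr. Qed.

HB.instance Definition _ :=
  GRing.isZmodule.Build P prod_addA prod_addC prod_add0 prod_addN.

Fact prod_mulA : associative (fun x y : P => (fun i => x i * y i) : P).
Proof. by move=> x y z; apply: functional_extensionality_dep => i; rewrite mulrA. Qed.
Fact prod_mul1 :
  left_id ((fun i => 1) : P) (fun x y : P => (fun i => x i * y i) : P).
Proof. by move=> x; apply: functional_extensionality_dep => i; rewrite mul1r. Qed.
Fact prod_mulr1 :
  right_id ((fun i => 1) : P) (fun x y : P => (fun i => x i * y i) : P).
Proof. by move=> x; apply: functional_extensionality_dep => i; rewrite mulr1. Qed.
Fact prod_mulDl : left_distributive (fun x y : P => (fun i => x i * y i) : P) +%R.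
Proof. by move=> x y z; apply: functional_extensionality_dep => i; apply: mulrDl. Qed.
Fact prod_mulDr : right_distributive (fun x y : P => (fun i => x i * y i) : P) +%R.
Proof. by move=> x y z; apply: functional_extensionality_dep => i; apply: mulrDr. Qed.

HB.instance Definition _ := GRing.Zmodule_isPzRing.Build P
  prod_mulA prod_mul1 prod_mulr1 prod_mulDl prod_mulDr.

End ProdRing.

Definition in_direct_sum (I : Type) (R : I -> pzRingType)
    (J : forall i, twoSidedIdeal (R i)) : prod_ring R -> bool :=
  fun x => `[< (forall i, x i \in J i) /\ finite_set [set i | x i != 0] >].

Section DirectSumIdeal.
Variables (I : Type) (R : I -> pzRingType) (J : forall i, twoSidedIdeal (R i)).

Fact direct_sum_zmod : zmod_closed (in_direct_sum J).
Proof.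
split.
  apply/asboolP; split=> [i|]; first exact: rpred0.
  by apply: (sub_finite_set _ (finite_set0 I)) => i /=; rewrite eqxx.
move=> x y /asboolP[xJ xf] /asboolP[yJ yf]; apply/asboolP; split=> [i|].
  exact: rpredB (xJ i) (yJ i).
have: finite_set ([set i | x i != 0] `|` [set i | y i != 0]).
  by rewrite finite_setU.
apply: sub_finite_set => i /= xyi.
have [xi|] := eqVneq (x i) 0; [right | by left].
by apply: contra_neq xyi => yi; rewrite -[LHS]/(x i - y i) xi yi subr0.
Qed.

HB.instance Definition _ :=
  GRing.isZmodClosed.Build (prod_ring R) (in_direct_sum J) direct_sum_zmod.

Fact direct_sum_mull a x :
  x \in in_direct_sum J -> a * x \in in_direct_sum J.
Proof.
move=> /asboolP[xJ xf]; apply/asboolP; split=> [i|]; first exact: ideal_mull.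
apply: sub_finite_set xf => i /=; apply: contra_neq => xi.
by rewrite -[LHS]/(a i * x i) xi mulr0.
Qed.

Fact direct_sum_mulr a x :
  x \in in_direct_sum J -> x * a \in in_direct_sum J.
Proof.
move=> /asboolP[xJ xf]; apply/asboolP; split=> [i|]; first exact: ideal_mulr.
apply: sub_finite_set xf => i /=; apply: contra_neq => xi.
by rewrite -[LHS]/(x i * a i) xi mul0r.
Qed.

HB.instance Definition _ := isTwoSidedIdeal.Build (prod_ring R)
  (in_direct_sum J) direct_sum_mull direct_sum_mulr.

Definition direct_sum_ideal : twoSidedIdeal (prod_ring R) :=
  TwoSidedIdeal.clone _ (in_direct_sum J) _.

End DirectSumIdeal.

(* Subrings are not required to contain 1: the identity of a nonperiodic group
   is not uniform, so UI(A) is in general a subring of E(A) in this sense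
   only. *)
Definition subring (R : pzRingType) (S : set R) :=
  [/\ S 0, forall x y, S x -> S y -> S (x - y)
    & forall x y, S x -> S y -> S (x * y)].

Definition ring_isomorphic (R R' : pzRingType) (S : set R) (S' : set R') :=
  exists f : R -> R',
    [/\ set_bij S S' f,
        forall x y, S x -> S y -> f (x + y) = f x + f y
      & forall x y, S x -> S y -> f (x * y) = f x * f y].

Definition prime_number := {p : nat | prime p}.

Section Padic.
Variable p : prime_number.

(* Q_p^* as the inverse limit of the rings Z/p, Z/p^2, Z/p^3, ...; the
   component of index n lives in Z/p^(n+1). *)
Definition padic_coherent : prod_ring (fun n => 'Z_(val p ^ n.+1)) -> bool :=
  fun x => `[< forall n, (x n.+1 = x n %[mod val p ^ n.+1])%N >].

Fact padic_coherent_subring : subring_closed padic_coherent.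
Proof.
have pgt1 n : (1 < val p ^ n.+1)%N.
  by rewrite -{1}(exp1n n.+1) ltn_exp2r// prime_gt1// (valP p).
have modK k d m : d = m -> ((k %% d) %% m = k %% m)%N.
  by move=> ->; rewrite modn_mod.
have resD n (a b : 'Z_(val p ^ n.+1)) :
    ((a + b)%R = a + b %[mod val p ^ n.+1])%N.
  exact: modK (Zp_cast (pgt1 n)).
have resM n (a b : 'Z_(val p ^ n.+1)) :
    ((a * b)%R = a * b %[mod val p ^ n.+1])%N.
  exact: modK (Zp_cast (pgt1 n)).
have down n (a b : nat) :
    (a = b %[mod val p ^ n.+2] -> a = b %[mod val p ^ n.+1])%N.
  have dvd : (val p ^ n.+1 %| val p ^ n.+2)%N by rewrite dvdn_exp2l.
  by move=> ab; rewrite -(modn_dvdm a dvd) ab modn_dvdm.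
split=> [|x y /asboolP xc /asboolP yc|x y /asboolP xc /asboolP yc];
  apply/asboolP => n.
- exact: erefl.
- change (nat_of_ord (x n.+1 - y n.+1)%R
    = nat_of_ord (x n - y n)%R %[mod val p ^ n.+1])%N.
  apply/eqP; rewrite -(eqn_modDr (y n)) -[X in _ == X]resD subrK -xc.
  rewrite -modnDmr -yc modnDmr -{2}(subrK (y n.+1) (x n.+1)).
  exact/eqP/esym/down/resD.
- change (nat_of_ord (x n.+1 * y n.+1)%R
    = nat_of_ord (x n * y n)%R %[mod val p ^ n.+1])%N.
  by rewrite resM -modnMm -xc -yc modnMm; apply/down/resM.
Qed.

HB.instance Definition _ :=
  GRing.isSubringClosed.Build _ padic_coherent padic_coherent_subring.

Definition padic := {x | padic_coherent x}.

HB.instance Definition _ := SubChoice.copy padic {x | padic_coherent x}.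
HB.instance Definition _ :=
  GRing.SubChoice_isSubPzRing.Build _ _ padic padic_coherent_subring.

Fact padic_mulC : commutative (@GRing.mul padic).
Proof.
move=> x y; apply: val_inj; rewrite !rmorphM.
by apply: functional_extensionality_dep => n; apply: mulrC.
Qed.

HB.instance Definition _ := GRing.PzRing_hasCommutativeMul.Build padic padic_mulC.

(* Representative in {0, ..., p^(n+1) - 1} of the class of a mod p^(n+1). *)
Definition padic_res (a : padic) (n : nat) : nat := val a n.

(* The ideal (p^e) of Q_p^*; None stands for e = oo and p^oo = 0. *)
Definition in_padic_ideal (e : option nat) : padic -> bool :=
  let g : padic := if e is Some k then (val p)%:R ^+ k else 0 in
  fun x => `[< exists y, x = y * g >].

Fact padic_ideal_zmod e : zmod_closed (in_padic_ideal e).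
Proof.
split; first by apply/asboolP; exists 0; rewrite mul0r.
move=> _ _ /asboolP[x ->] /asboolP[y ->]; apply/asboolP; exists (x - y).
by rewrite mulrBl.
Qed.

HB.instance Definition _ e :=
  GRing.isZmodClosed.Build padic (in_padic_ideal e) (padic_ideal_zmod e).

Fact padic_ideal_mull e (a x : padic) :
  x \in in_padic_ideal e -> a * x \in in_padic_ideal e.
Proof.
by move=> /asboolP[y ->]; apply/asboolP; exists (a * y); rewrite mulrA.
Qed.

Fact padic_ideal_mulr e (a x : padic) :
  x \in in_padic_ideal e -> x * a \in in_padic_ideal e.
Proof. by rewrite padic_mulC; apply: padic_ideal_mull. Qed.

HB.instance Definition _ e := isTwoSidedIdeal.Build padic (in_padic_ideal e)
  (@padic_ideal_mull e) (@padic_ideal_mulr e).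

Definition padic_ideal e : twoSidedIdeal padic :=
  TwoSidedIdeal.clone _ (in_padic_ideal e) _.

End Padic.

Definition periodic (G : zmodType) :=
  forall x : G, exists2 n : nat, (0 < n)%N & x *+ n = 0.

Definition is_torsion (A : zmodType) : A -> bool :=
  fun x => `[< exists2 n : nat, (0 < n)%N & x *+ n = 0 >].

Fact torsion_zmod (A : zmodType) : zmod_closed (@is_torsion A).
Proof.
split; first by apply/asboolP; exists 1.
move=> x y /asboolP[m m0 xm] /asboolP[n n0 yn]; apply/asboolP.
exists (m * n)%N; first by rewrite muln_gt0 m0.
by rewrite mulrnBl mulrnA xm mul0rn mulnC mulrnA yn mul0rn subrr.
Qed.

HB.instance Definition _ (A : zmodType) :=
  GRing.isZmodClosed.Build A (@is_torsion A) (@torsion_zmod A).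

Definition torsion (A : zmodType) : zmodClosed A :=
  GRing.ZmodClosed.clone A (@is_torsion A) _.

Definition independent (G : zmodType) (m : nat) (x : 'I_m -> G) :=
  forall c : 'I_m -> int, \sum_i x i *~ c i = 0 -> forall i, c i = 0.

Definition finite_rank (G : zmodType) :=
  exists n : nat, forall m (x : 'I_m -> G), independent x -> (m <= n)%N.

Definition finite_torsionfree_rank (A : zmodType) :=
  finite_rank {quot torsion A}.

Definition is_basis (A : zmodType) (B : set A) (F : zmodClosed A) :=
  (forall m (x : 'I_m -> A), injective x -> (forall i, B (x i)) -> independent x)
  /\ forall y, y \in F <->
       exists m (x : 'I_m -> A) (c : 'I_m -> int),
         (forall i, B (x i)) /\ y = \sum_i x i *~ c i.

Definition free_abelian (A : zmodType) (F : zmodClosed A) :=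
  exists B : set A, is_basis B F.

(* H has finite index in K, where H is a subgroup of K. *)
Definition finite_index (A : zmodType) (H : zmodClosed A) (K : set A) :=
  finite_set (\pi_({quot H}) @` K).

Definition endo (A : zmodType) := {additive A -> A}.

Section EndoRing.
Variable A : zmodType.
Local Notation E := (endo A).

Lemma endo_eqP (f g : E) : f =1 g -> f = g.
Proof.
case: f g => [f cf] [g cg] /= /funext fg; subst g; congr GRing.Additive.Pack.
case: cf cg => [[f1]] [[f2]]; congr (GRing.Additive.Class (_ _)).
exact: Prop_irrelevance.
Qed.

HB.instance Definition _ := gen_eqMixin E.
HB.instance Definition _ := gen_choiceMixin E.

Definition endo0 : E := \0%R.
Definition endo1 : E := idfun.
Definition endo_opp (f : E) : E := (\- f)%R.
Definition endo_add (f g : E) : E := (f \+ g)%R.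
Definition endo_mul (f g : E) : E := f \o g.

Fact endo_addA : associative endo_add.
Proof. by move=> f g h; apply: endo_eqP => x; apply: addrA. Qed.
Fact endo_addC : commutative endo_add.
Proof. by move=> f g; apply: endo_eqP => x; apply: addrC. Qed.
Fact endo_add0 : left_id endo0 endo_add.
Proof. by move=> f; apply: endo_eqP => x; apply: add0r. Qed.
Fact endo_addN : left_inverse endo0 endo_opp endo_add.
Proof. by move=> f; apply: endo_eqP => x; apply: addNr. Qed.

HB.instance Definition _ :=
  GRing.isZmodule.Build E endo_addA endo_addC endo_add0 endo_addN.

Fact endo_mulA : associative endo_mul.
Proof. by move=> f g h; apply: endo_eqP. Qed.
Fact endo_mul1 : left_id endo1 endo_mul.
Proof. by move=> f; apply: endo_eqP. Qed.
Fact endo_mulr1 : right_id endo1 endo_mul.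
Proof. by move=> f; apply: endo_eqP. Qed.
Fact endo_mulDl : left_distributive endo_mul +%R.
Proof. by move=> f g h; apply: endo_eqP. Qed.
Fact endo_mulDr : right_distributive endo_mul +%R.
Proof. by move=> f g h; apply: endo_eqP => x; apply: (raddfD f). Qed.

HB.instance Definition _ := GRing.Zmodule_isPzRing.Build E
  endo_mulA endo_mul1 endo_mulr1 endo_mulDl endo_mulDr.

Definition is_finitary : E -> bool := fun f => `[< finite_set (range f) >].

Fact finitary_zmod : zmod_closed is_finitary.
Proof.
split.
  apply/asboolP; apply: (sub_finite_set _ (finite_set1 (0 : A))).
  by move=> _ [x _ <-].
move=> f g /asboolP fF /asboolP gF; apply/asboolP.
apply: sub_finite_set (finite_image2 (fun x y : A => x - y) fF gF).
by move=> _ [x _ <-]; exists (f x); [exists x | exists (g x); [exists x|]].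
Qed.

HB.instance Definition _ := GRing.isZmodClosed.Build E is_finitary finitary_zmod.

Fact finitary_mull (f g : E) : g \in is_finitary -> f * g \in is_finitary.
Proof.
move=> /asboolP gF; apply/asboolP.
apply: sub_finite_set (finite_image f gF).
by move=> _ [x _ <-]; exists (g x) => //; exists x.
Qed.

Fact finitary_mulr (f g : E) : g \in is_finitary -> g * f \in is_finitary.
Proof.
move=> /asboolP gF; apply/asboolP; apply: sub_finite_set gF.
by move=> _ [x _ <-]; exists (f x).
Qed.

HB.instance Definition _ :=
  isTwoSidedIdeal.Build E is_finitary finitary_mull finitary_mulr.

Definition finitary : twoSidedIdeal E := TwoSidedIdeal.clone _ is_finitary _.

Definition inertial (f : E) :=
  forall H : zmodClosed A,
    finite_index H [set x + f y | x in [set` H] & y in [set` H]].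

Definition invariant (f : E) (H : zmodClosed A) :=
  forall x, x \in H -> f x \in H.

End EndoRing.

Definition Jring := prod_ring (fun p : prime_number => padic p).

(* For F <= A0 <= A with A0/F periodic and f leaving A0 and F invariant: f acts
   on A0/F as multiplication by alpha. A coset x + F with p^(n+1) x in F is
   multiplied by alpha_p, i.e. by any integer congruent to alpha_p modulo
   p^(n+1); as A0/F is the direct sum of its p-components and f is additive,
   this describes the action of f on all of A0/F. *)
Definition acts_as (A : zmodType) (f : endo A) (A0 F : {pred A})
    (alpha : Jring) :=
  forall (p : prime_number) (n : nat) (x : A),
    x \in A0 -> x *+ (val p ^ n.+1) \in F ->
    f x - x *+ padic_res (alpha p) n \in F.

(* M(A) and FM(A); meaningful for A periodic. *)
Definition multiplications (A : zmodType) : set (endo A) :=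
  [set f | exists alpha : Jring, acts_as f predT (pred1 0) alpha].

Definition finitary_multiplications (A : zmodType) : set (endo A) :=
  [set f | exists A0 : zmodClosed A,
    [/\ finite_index A0 [set: A], invariant f A0
      & exists alpha : Jring, acts_as f A0 (pred1 0) alpha]].

Definition uniform (A : zmodType) (f : endo A) :=
  inertial f /\
  exists F A0 : zmodClosed A,
    [/\ {subset F <= A0}, invariant f F & invariant f A0] /\
    [/\ finite_index A0 [set: A],
        forall x, x \in A0 -> exists2 n : nat, (0 < n)%N & x *+ n \in F,
        exists alpha : Jring, acts_as f A0 F alpha,
        free_abelian F
      & forall x, x \in F -> f x = 0].

Definition UI (A : zmodType) : set (endo A) := [set f | uniform f].
Arguments UI : clear implicits.

(* UI(A)/F(A), inside the ring E(A)/F(A). *)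
Definition UI_mod_F (A : zmodType) : set (factor_ring (finitary A)) :=
  factor_pi (finitary A) @` UI A.

Arguments multiplications : clear implicits.
Arguments finitary_multiplications : clear implicits.
Arguments UI_mod_F : clear implicits.

(* The least n such that P n, or None (for oo) if there is none. *)
Definition least (P : nat -> Prop) : option nat :=
  if pselect (exists n, `[< P n >]) is left ex then Some (ex_minn ex) else None.

Section Hring.
Variables (A : zmodType) (F : zmodClosed A).

Definition p_component (p : prime_number) : set {quot F} :=
  [set x | exists k, x *+ (val p ^ k) = 0].

(* e_p: the bound of a bounded p-group is a power of p, so it is enough to look
   at annihilators of this form. *)
Definition bound_exp (p : prime_number) : option nat :=
  least (fun e => forall x, p_component p x -> x *+ (val p ^ e) = 0).

Definition finite_exp (p : prime_number) : option nat :=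
  if bound_exp p is Some _ then
    least (fun e => finite_set [set x *+ (val p ^ e) | x in p_component p])
  else None.

Definition Hnum :=
  prod_ring (fun p : prime_number => factor_ring (padic_ideal p (bound_exp p))).

Definition Hden : twoSidedIdeal Hnum :=
  direct_sum_ideal (fun p : prime_number =>
    image_ideal (padic_ideal p (bound_exp p)) (padic_ideal p (finite_exp p))).

(* H(A), for F a free abelian subgroup of A such that A/F is periodic. *)
Definition Hring := factor_ring Hden.

End Hring.

(* Main.v *)
From HB Require Import structures.
Require Import Defs.
From mathcomp Require Import all_boot all_order all_algebra.
From mathcomp Require Import generic_quotient ring_quotient.
From mathcomp Require Import boolp classical_sets functions cardinality.

Set Implicit Arguments.
Unset Strict Implicit.
Unset Printing Implicit Defensive.

Import Order.TTheory GRing.Theory Num.Theory.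

Local Open Scope ring_scope.
Local Open Scope quotient_scope.
Local Open Scope classical_set_scope.

(** Let F be a free subgroup of A with A/F periodic. The ring J acts on A/F, and
    an endomorphism f of A is uniform as soon as, for some such F and some
    alpha in J, f kills F and the additive map
      deviation : x |-> f x + F - alpha (x + F),  from A to A/F,
    has finite image: its kernel then serves as the subgroup A0 of the
    definition. Finite torsion-free rank makes F finitely generated, and then
    inertiality comes for free (almost_acts_inertial): modulo a subgroup H, the
    values f y with y in H and with zero deviation are torsion elements of the
    finitely generated group (F + H)/H, of which there are finitely many. So
    everything reduces to the relation uniform_by f alpha.

    Two subgroups F and F' as above contain a common one of finite index in both
    (full_meet), and passing to it does not change whether a deviation has
    finite image (almost_actsS). Hence the relation is compatible with
    differences and products, and UI(A) is a subring; an endomorphism with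
    finite image is related to 0. If f is related to alpha then f is finitary
    iff alpha acts on A/F with finite image, for any F (uniform_by_finitary):
    modulo F, f and alpha differ by a map with finite image, and the values of
    f, being torsion, are determined by their classes modulo F.

    The natural map theta from J onto H(A) has the same kernel, the alpha that
    act on A/F with finite image (theta_eq0). One prime at a time, a nonzero
    alpha_p is a unit times p^k, so it acts on the p-component as p^k does up to
    an automorphism; it kills the component iff e_p <= k and has finite image
    there iff epsilon_p <= k. Globally, alpha has finite image iff it has finite
    image on every component and kills almost all of them (finite_jact).

    Therefore f |-> theta alpha is well defined and injective on UI(A)/F(A)
    (correspondence_iso). When A is periodic, every alpha is related to the
    multiplication by alpha, so the map is onto. In general A/F itself is a
    periodic quotient of A on which J has the same finitary elements. *)

(** * Finite sets and factor groups *)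

(** Choose a preimage in [S] of each of the finitely many values of [g]; every
    element of [S] differs from one of them by an element of the kernel. *)
Lemma finite_extension (G G' G'' : zmodType) (g : G -> G') (h : G -> G'')
    (S : set G) :
    zmod_morphism g -> zmod_morphism h ->
    (forall x y, S x -> S y -> S (x - y)) ->
    finite_set (g @` S) -> finite_set (h @` [set x | S x /\ g x = 0]) ->
  finite_set (h @` S).
Proof.
move=> gB hB SB imf kerf.
have pre (y : G') : exists x, (exists z, S z /\ g z = y) -> S x /\ g x = y.
  by have [[z zP]|no] := pselect (exists z, S z /\ g z = y); [exists z | exists 0].
have [s sP] := choice pre.
apply: sub_finite_set (finite_image2 (fun x y => x + h (s y)) kerf imf).
move=> _ [x Sx <-].
have [Ss gs] : S (s (g x)) /\ g (s (g x)) = g x by apply: sP; exists x.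
exists (h x - h (s (g x))); last by exists (g x); [exists x | rewrite subrK].
by exists (x - s (g x)); rewrite ?hB//=; split; [exact: SB | rewrite gB gs subrr].
Qed.

Lemma finite_index_kernel (G G' : zmodType) (g : G -> G') (K : zmodClosed G)
    (S : set G) :
  zmod_morphism g -> (forall x, x \in K <-> g x = 0) -> finite_set (g @` S) ->
  finite_index K S.
Proof.
move=> gB KP imf.
(* The class of [z] mod [K] is a function of [g z]. *)
have pre (y : G') : exists q : {quot K},
    forall z, g z = y -> \pi_({quot K}) z = q.
  have [[z gz]|no] := pselect (exists z, g z = y); last first.
    by exists 0 => z gz; case: no; exists z.
  exists (\pi z) => w gw; apply/eqP; rewrite -Quotient.idealrBE.
  by apply/KP; rewrite gB gw gz subrr.
have [s sP] := choice pre.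
apply: sub_finite_set (finite_image s imf) => _ [x Sx <-].
by exists (g x); [exists x | exact/esym/sP].
Qed.

Section Factor.
Variables (A : zmodType) (F : zmodClosed A).

Lemma quot_eqP (x y : A) :
  reflect (\pi_({quot F}) x = \pi_({quot F}) y) (x - y \in F).
Proof. by rewrite Quotient.idealrBE; apply: eqP. Qed.

Lemma quot_eq0 (x : A) : \pi_({quot F}) x = 0 <-> x \in F.
Proof.
rewrite -(raddf0 \pi_({quot F})).
by split=> [/quot_eqP|xF]; [rewrite subr0 | apply/quot_eqP; rewrite subr0].
Qed.

Lemma quot_piB : zmod_morphism \pi_({quot F}).
Proof. exact: raddfB. Qed.

Lemma quot_torsion (x : A) n : \pi_({quot F}) x *+ n = 0 <-> x *+ n \in F.
Proof. by rewrite -raddfMn; exact: quot_eq0. Qed.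

Lemma periodic_quotP : periodic {quot F} <->
  forall x, exists2 n : nat, (0 < n)%N & x *+ n \in F.
Proof.
split=> h x.
  by have [n n0 /quot_torsion] := h (\pi x); exists n.
by rewrite -[x]reprK; have [n n0 /quot_torsion] := h (repr x); exists n.
Qed.

End Factor.

(** * Finitely generated subgroups *)

(** Subgroups here have boolean membership, hence the reflected existential. *)
Definition in_zspan (A : zmodType) (m : nat) (x : 'I_m -> A) : A -> bool :=
  fun y => `[< exists c : 'I_m -> int, y = \sum_i x i *~ c i >].

Section Span.
Variables (A : zmodType) (m : nat) (x : 'I_m -> A).

Fact zspan_zmod : zmod_closed (in_zspan x).
Proof.
split; first by apply/asboolP; exists (fun=> 0); rewrite big1// => i _; rewrite mulr0z.
move=> _ _ /asboolP[c ->] /asboolP[d ->]; apply/asboolP.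
exists (fun i => c i - d i); rewrite -sumrB; apply: eq_bigr => i _.
by rewrite mulrzBr.
Qed.

HB.instance Definition _ := GRing.isZmodClosed.Build A (in_zspan x) zspan_zmod.

Definition zspan : zmodClosed A := GRing.ZmodClosed.clone A (in_zspan x) _.

Lemma zspanP y : reflect (exists c : 'I_m -> int, y = \sum_i x i *~ c i) (y \in zspan).
Proof. exact: asboolP. Qed.

Lemma mem_zspan i : x i \in zspan.
Proof.
apply/zspanP; exists (fun j => (j == i)%:Z).
rewrite (bigD1 i)//= eqxx mulr1z big1 ?addr0// => j /negPf ->.
by rewrite mulr0z.
Qed.

(** If [N i] kills [x i], a combination of the [x i] depends only on the
    residues mod [N i] of its coefficients. *)
Lemma finite_zspan : (forall i, exists2 n : nat, (0 < n)%N & x i *+ n = 0) ->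
  finite_set [set` zspan].
Proof.
move=> tors; have [N N0 NP] := fin_all_exists2 tors.
pose M := (\max_i N i)%N.
have fin : finite_set [set: {ffun 'I_m -> 'I_M.+1}] by exact: finite_finset.
pose comb (d : {ffun 'I_m -> 'I_M.+1}) := \sum_i x i *+ d i.
apply: sub_finite_set (finite_image comb fin) => y /= /zspanP[c ->].
exists [ffun i => inord `|(c i %% N i)%Z|%N] => //; rewrite /comb.
apply: eq_bigr => i _; rewrite ffunE inordK; last first.
  rewrite ltnS (leq_trans _ (leq_bigmax i))// ltnW// -ltz_nat gez0_abs.
    by rewrite ltz_pmod// ltz_nat.
  by rewrite modz_ge0// gt_eqF// ltz_nat.
rewrite pmulrn gez0_abs ?modz_ge0 ?gt_eqF ?ltz_nat//.
rewrite [in RHS](divz_eq (c i) (N i)) [RHS]mulrzDr mulrzA mulrzAC -pmulrn NP.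
by rewrite mul0rz add0r.
Qed.

End Span.

Lemma torsionP (G : zmodType) (x : G) :
  reflect (exists2 n : nat, (0 < n)%N & x *+ n = 0) (x \in torsion G).
Proof. exact: asboolP. Qed.

Section MaximalIndependent.
Variable A : zmodType.

Lemma independent_inj m (x : 'I_m -> A) : independent x -> injective x.
Proof.
move=> ix i j xij; apply/eqP/negP => /negP nij.
have E (k : 'I_m) : \sum_l x l *~ (l == k)%:Z = x k.
  rewrite (bigD1 k)//= eqxx mulr1z big1 ?addr0// => l /negPf ->.
  by rewrite mulr0z.
have /ix/(_ i) : \sum_l x l *~ ((l == i)%:Z - (l == j)%:Z) = 0.
  under eq_bigr do rewrite mulrzBr.
  by rewrite sumrB !E xij subrr.
by rewrite eqxx (negPf nij).
Qed.

Lemma independent_torsionfree m (x : 'I_m -> A) y n :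
  independent x -> (0 < n)%N -> y \in zspan x -> y *+ n = 0 -> y = 0.
Proof.
move=> ix n0 /zspanP[c ->]; rewrite -sumrMnl => h.
rewrite big1// => i _; suff -> : c i = 0 by rewrite mulr0z.
have /(_ i) : forall i, c i * n%:Z = 0.
  apply: ix; rewrite -[RHS]h; apply: eq_bigr => j _.
  by rewrite mulrzA -pmulrn.
by move/eqP; rewrite mulf_eq0 => /orP[/eqP//|/eqP[]] n00; rewrite n00 in n0.
Qed.

(** Take an independent family of maximal size: adjoining [b] makes it
    dependent, and in the resulting relation [b] has a nonzero coefficient. *)
Lemma max_independent (B : set A) n :
    (forall m (x : 'I_m -> A), (forall i, B (x i)) -> independent x -> (m <= n)%N) ->
  exists m (x : 'I_m -> A), [/\ forall i, B (x i), independent x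
    & forall b, B b -> exists2 k, (0 < k)%N & b *+ k \in zspan x].
Proof.
move=> bnd.
pose P m := `[< exists x : 'I_m -> A, (forall i, B (x i)) /\ independent x >].
have P0 : exists m, P m.
  exists 0%N; apply/asboolP; exists (fun=> 0); split; first by case.
  by move=> c _; case.
have Pn m : P m -> (m <= n)%N by move=> /asboolP[x [Bx ix]]; exact: bnd ix.
case: (ex_maxnP P0 Pn) => m /asboolP[x [Bx ix]] mmax; exists m, x; split=> // b Bb.
apply: contrapT => nb.
suff /mmax : P m.+1 by rewrite ltnn.
(* The family [x] with [b] adjoined at index [ord0]. *)
apply/asboolP; exists (fun i => oapp x b (unlift ord0 i)); split.
  by move=> i; case: (unlift ord0 i) => [j|] /=.
move=> c; rewrite big_ord_recl unlift_none /=.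
under eq_bigr do rewrite liftK /=.
move=> h; have c0 : c ord0 = 0.
  apply: contrapT => /eqP c0; apply: nb; exists `|c ord0|%N; first by rewrite absz_gt0.
  have bs : b *~ c ord0 \in zspan x.
    move/eqP: h; rewrite addr_eq0 => /eqP ->; rewrite rpredN; apply/zspanP.
    by exists (fun i => c (lift ord0 i)).
  by case: (c ord0) bs => k /=; rewrite ?pmulrn// NegzE mulrNz rpredN.
move: h; rewrite c0 mulr0z add0r => /ix h i.
by case: (unliftP ord0 i) => [j|] ->.
Qed.

(** A maximal independent family of generators spans a subgroup of finite index
    that is torsion-free, so the torsion elements inject into the finite
    factor group. *)
Lemma finite_torsion_zspan m (x : 'I_m -> A) :
  finite_set [set y | y \in zspan x /\ y \in torsion A].
Proof.
have [|k [y [ry iy yP]]] := @max_independent (range x) m.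
  move=> k y ry /independent_inj iy.
  have [s _ sP] := fin_all_exists2 ry.
  have sinj : injective s.
    by move=> i j sij; apply: iy; rewrite -(sP i) -(sP j) sij.
  by have := leq_card s sinj; rewrite !card_ord.
rewrite -[X in finite_set X]image_id.
apply: (@finite_extension _ _ _ \pi_({quot zspan y}) idfun).
- exact: raddfB.
- by [].
- by move=> u v [us ut] [vs vt]; split; apply: rpredB.
- have fin : finite_set [set` zspan (\pi_({quot zspan y}) \o x)].
    apply: finite_zspan => i; have [//|n n0 xn] := yP (x i).
    by exists n => //; apply/quot_torsion.
  apply: sub_finite_set fin => _ [u [/zspanP[c ->] _] <-] /=.
  apply/zspanP; exists c; rewrite raddf_sum; apply: eq_bigr => i _.
  by rewrite raddfMz.
- apply: sub_finite_set (finite_set1 0) => _ [u [[_ /torsionP[n n0 un0]] /quot_eq0 us] <-].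
  exact: independent_torsionfree iy n0 us un0.
Qed.

End MaximalIndependent.

(** * Free subgroups with periodic factor group *)

(** Free of finite rank. Over a group of finite torsion-free rank this is the
    same as being free (free_abelian_fg, free_fg_abelian), but it provides a
    basis indexed by an ordinal. *)
Definition free_fg (A : zmodType) (F : zmodClosed A) :=
  exists m (x : 'I_m -> A), independent x /\ forall y, (y \in F) = (y \in zspan x).

Section FreeSubgroups.
Variable A : zmodType.

(** A relation modulo the torsion subgroup becomes a relation in [A] after
    multiplication by a positive integer, so independence passes to the
    torsion-free quotient. *)
Lemma independent_bound : finite_torsionfree_rank A ->
  exists n, forall m (x : 'I_m -> A), independent x -> (m <= n)%N.
Proof.
case=> n bnd; exists n => m x ix; apply: (bnd m (\pi_({quot torsion A}) \o x)).
move=> c h i.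
have /asboolP[k k0 hk] : \sum_i x i *~ c i \in torsion A.
  apply/quot_eq0; rewrite -[RHS]h raddf_sum; apply: eq_bigr => j _.
  by rewrite raddfMz.
have /(_ i)/eqP : forall i, c i * k%:Z = 0.
  apply: ix; rewrite -[RHS]hk -sumrMnl; apply: eq_bigr => j _.
  by rewrite mulrzA -pmulrn.
by rewrite mulf_eq0 => /orP[/eqP//|/eqP[]] k00; rewrite k00 in k0.
Qed.

(** Subfamilies of a basis are independent, hence of bounded size; a maximal one
    exhausts the basis. *)
Lemma free_abelian_fg (F : zmodClosed A) :
  finite_torsionfree_rank A -> free_abelian F -> free_fg F.
Proof.
move=> /independent_bound[n bnd] [B [Bind BF]].
have [|m [x [Bx ix xB]]] := @max_independent A B n.
  by move=> m x _; exact: bnd.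
exists m, x; split=> // y; apply/idP/idP => [/BF|/zspanP[c ->]]; last first.
  by apply/BF; exists m, x, c.
move=> [k [z [c [Bz ->]]]]; apply: rpred_sum => i _.
suff [j <-] : exists j, x j = z i by rewrite rpredMz// mem_zspan.
apply: contrapT => nz; have [l l0 /zspanP[d zd]] := xB _ (Bz i).
(* Otherwise [z i] could be adjoined to [x], contradicting the relation [zd]. *)
pose w j := oapp x (z i) (unlift ord0 j).
have winj : injective w.
  move=> a b; rewrite /w.
  case: (unliftP ord0 a) => [a'|] ->; case: (unliftP ord0 b) => [b'|] -> //=.
  - by move/(independent_inj ix) ->.
  - by move=> h; case: nz; exists a'.
  - by move=> h; case: nz; exists b'.
have Bw j : B (w j) by rewrite /w; case: (unlift ord0 j) => [j'|] /=.
pose e j := oapp (fun j => - d j) l%:Z (unlift ord0 j).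
have /(Bind _ w winj Bw)/(_ ord0) : \sum_j w j *~ e j = 0.
  rewrite big_ord_recl /w /e unlift_none /= -pmulrn zd -big_split big1// => j _ /=.
  by rewrite liftK /= mulrNz subrr.
by rewrite /e unlift_none /= => -[l00]; rewrite l00 in l0.
Qed.

Lemma free_fg_abelian (F : zmodClosed A) : free_fg F -> free_abelian F.
Proof.
move=> [m [x [ix xF]]]; exists (range x); split.
  move=> k z zinj rz; have [s _ sP] := fin_all_exists2 rz.
  have sinj : injective s by move=> i j sij; apply: zinj; rewrite -!sP sij.
  move=> c h i.
  have /ix/(_ (s i)) : \sum_j x j *~ (\sum_(i | s i == j) c i) = 0.
    rewrite -[RHS]h (partition_big s predT)//=; apply: eq_bigr => j _.
    rewrite mulrz_sumr.
    by apply: eq_bigr => a /eqP <-; rewrite sP.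
  by rewrite (big_pred1 i)// => a; rewrite /= (inj_eq sinj).
move=> y; rewrite xF; split=> [/zspanP[c ->]|[k [z [c [rz ->]]]]].
  by exists m, x, c.
by apply: rpred_sum => i _; case: (rz i) => j _ <-; rewrite rpredMz// mem_zspan.
Qed.

Lemma free_fg_torsion (F : zmodClosed A) y :
  free_fg F -> y \in F -> y \in torsion A -> y = 0.
Proof.
move=> [m [x [ix xF]]]; rewrite xF => ys /asboolP[n n0].
exact: independent_torsionfree ix n0 ys.
Qed.

(** The span of a maximal independent family. *)
Lemma exists_full : finite_torsionfree_rank A ->
  exists F : zmodClosed A, free_fg F /\ periodic {quot F}.
Proof.
move=> /independent_bound[n bnd].
have [|m [x [_ ix xB]]] := @max_independent A setT n.
  by move=> m x _; exact: bnd.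
exists (zspan x); split; first by exists m, x.
by apply/periodic_quotP => y; exact: xB.
Qed.

Lemma finite_fg_periodic (F K : zmodClosed A) :
  free_fg F -> periodic {quot K} -> finite_set (\pi_({quot K}) @` [set` F]).
Proof.
move=> [m [x [_ xF]]] per.
have := @finite_zspan _ m (\pi_({quot K}) \o x) (fun i => per _).
apply: sub_finite_set => _ [y yF <-] /=; move: yF; rewrite /= xF => /zspanP[c ->].
apply/zspanP; exists c; rewrite raddf_sum; apply: eq_bigr => i _.
by rewrite raddfMz.
Qed.

(** Some multiple of every basis element of [F] lies in [F']; these multiples
    span the required subgroup. *)
Lemma full_meet (F F' : zmodClosed A) :
    free_fg F -> periodic {quot F} -> periodic {quot F'} ->
  exists K : zmodClosed A, [/\ free_fg K, periodic {quot K},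
    {subset K <= F} & {subset K <= F'}].
Proof.
move=> [m [x [ix xF]]] perF /periodic_quotP perF'.
have [N N0 NP] := fin_all_exists2 (fun i => perF' (x i)).
exists (zspan (fun i => x i *+ N i)); split.
- exists m, (fun i => x i *+ N i); split=> // c h i.
  have /(_ i)/eqP : forall i, (N i)%:Z * c i = 0.
    by apply: ix; rewrite -[RHS]h; apply: eq_bigr => j _; rewrite mulrzA -pmulrn.
  by rewrite mulf_eq0 => /orP[/eqP[]N00|/eqP//]; have := N0 i; rewrite N00.
- set K := zspan _; move=> q; rewrite -[q]reprK; set y := repr q.
  have [k k0] := (periodic_quotP F).1 perF y; rewrite xF => /zspanP[c yc].
  have /asboolP[l l0 yl] : \pi_({quot K}) y *+ k \in torsion {quot K}.
    rewrite -(raddfMn \pi_({quot K})) yc raddf_sum; apply: rpred_sum => i _.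
    rewrite raddfMz; apply: rpredMz; apply/asboolP.
    by exists (N i) => //; apply/quot_torsion; apply: mem_zspan.
  by exists (k * l)%N; rewrite ?muln_gt0 ?k0// mulrnA.
- by move=> y /zspanP[c ->]; rewrite xF; apply: rpred_sum => i _;
    rewrite rpredMz// rpredMn// mem_zspan.
- by move=> y /zspanP[c ->]; apply: rpred_sum => i _; rewrite rpredMz.
Qed.

End FreeSubgroups.

(** * The action of the ring J on torsion elements *)

Section PadicResidues.
Variable p : prime_number.
Implicit Types a b : padic p.

Lemma ppow_gt1 n : (1 < val p ^ n.+1)%N.
Proof. by rewrite -{1}(exp1n n.+1) ltn_exp2r// prime_gt1// (valP p). Qed.

Lemma ppow_gt0 n : (0 < val p ^ n)%N.
Proof. by rewrite expn_gt0 prime_gt0// (valP p). Qed.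

Let modZ n k : (k %% (Zp_trunc (val p ^ n.+1)).+2 = k %[mod val p ^ n.+1])%N.
Proof. by rewrite Zp_cast ?ppow_gt1// modn_mod. Qed.

Lemma padic_resD a b n :
  (padic_res (a + b)%R n = padic_res a n + padic_res b n %[mod val p ^ n.+1])%N.
Proof. by rewrite /padic_res rmorphD; exact: modZ. Qed.

Lemma padic_resM a b n :
  (padic_res (a * b)%R n = padic_res a n * padic_res b n %[mod val p ^ n.+1])%N.
Proof. by rewrite /padic_res rmorphM; exact: modZ. Qed.

Lemma padic_res0 n : padic_res (0 : padic p) n = 0%N.
Proof. by rewrite /padic_res rmorph0. Qed.

Lemma padic_res1 n : (padic_res (1 : padic p)%R n = 1 %[mod val p ^ n.+1])%N.
Proof. by rewrite /padic_res rmorph1; exact: modZ. Qed.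

Lemma padic_resX k n :
  (padic_res ((val p)%:R ^+ k : padic p)%R n = val p ^ k %[mod val p ^ n.+1])%N.
Proof.
have natE j : (padic_res (j%:R : padic p)%R n = j %[mod val p ^ n.+1])%N.
  elim: j => [|j IH]; first by rewrite padic_res0.
  by rewrite -natr1 padic_resD -[in RHS](addn1 j) -modnDm IH padic_res1 modnDm.
by rewrite -natrX.
Qed.

Lemma padic_res_ltn a n : (padic_res a n < val p ^ n.+1)%N.
Proof. by have := ltn_ord (val a n); rewrite [X in (_ < X)%N]Zp_cast ?ppow_gt1. Qed.

Lemma padic_res_coherent a m n : (m <= n)%N ->
  (padic_res a n = padic_res a m %[mod val p ^ m.+1])%N.
Proof.
elim: n => [|n IH]; first by rewrite leqn0 => /eqP ->.
rewrite leq_eqVlt => /orP[/eqP -> //|]; rewrite ltnS => mn; rewrite -IH//.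
have dv : (val p ^ m.+1 %| val p ^ n.+1)%N by rewrite dvdn_exp2l.
have /asboolP/(_ n) := valP a => h.
by rewrite -(modn_dvdm (padic_res a n.+1) dv) [X in (X %% _)%N]h modn_dvdm.
Qed.

Lemma padic_eq a b : (forall n, padic_res a n = padic_res b n) -> a = b.
Proof.
move=> ab; apply: val_inj; apply: functional_extensionality_dep => n.
by apply: val_inj; exact: ab.
Qed.

Lemma exists_padic (s : nat -> nat) :
    (forall n, s n.+1 = s n %[mod val p ^ n.+1])%N ->
  exists a : padic p, forall n, padic_res a n = (s n %% val p ^ n.+1)%N.
Proof.
move=> sP.
pose x : prod_ring (fun n => 'Z_(val p ^ n.+1)) := fun n => inZp (s n).
have xE n : x n = (s n %% val p ^ n.+1)%N :> nat.
  by rewrite /x /= Zp_cast ?ppow_gt1.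
have xP : padic_coherent x.
  apply/asboolP => n; rewrite !xE modn_mod modn_dvdm ?sP//.
  by rewrite dvdn_exp2l.
by exists (exist _ x xP) => n; rewrite -xE.
Qed.

End PadicResidues.

(** J is the ring of profinite integers, and [a] is a representative of the
    class of [alpha] mod [N], hence an integer by which [alpha] acts on the
    elements killed by [N]. With all moduli [N] allowed, the action can be
    defined without splitting elements into primary components. *)
Definition represents (alpha : Jring) (N a : nat) :=
  forall (p : prime_number) n, (val p ^ n.+1 %| N)%N ->
    (a = padic_res (alpha p) n %[mod val p ^ n.+1])%N.

Section Represents.
Implicit Types (alpha beta : Jring).

Lemma prime_power_dvd N d : (0 < N)%N ->
    (forall (p : prime_number) n, (val p ^ n.+1 %| N)%N -> (val p ^ n.+1 %| d)%N) ->
  (N %| d)%N.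
Proof.
move=> N0 h; apply/dvdn_partP => // p pN.
have pp : prime p by have := pN; rewrite mem_primes => /andP[].
rewrite p_part; have : (0 < logn p N)%N by rewrite logn_gt0.
case E: (logn p N) => [//|n] _; apply: (h (exist _ p pp)).
by rewrite /= -E pfactor_dvdnn.
Qed.

Lemma represents_unique alpha N a b : (0 < N)%N ->
  represents alpha N a -> represents alpha N b -> (a = b %[mod N])%N.
Proof.
move=> N0; wlog ab : a b / (a <= b)%N.
  by move=> h ra rb; case/orP: (leq_total a b) => ab; [|symmetry]; exact: h.
move=> ra rb; apply/esym/eqP; rewrite eqn_mod_dvd//; apply: prime_power_dvd => // p n pn.
by rewrite -eqn_mod_dvd// (ra p n pn) (rb p n pn).
Qed.

Lemma represents_dvd alpha N N' a : (N' %| N)%N ->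
  represents alpha N a -> represents alpha N' a.
Proof. by move=> NN ra p n pn; apply: ra; exact: dvdn_trans NN. Qed.

Lemma represents_prime alpha (p : prime_number) n :
  represents alpha (val p ^ n.+1) (padic_res (alpha p) n).
Proof.
move=> q k qp; suff E : p = q.
  subst q; move: qp; rewrite dvdn_Pexp2l ?prime_gt1 ?(valP p)// ltnS => kn.
  exact: padic_res_coherent.
apply: val_inj; apply/esym/eqP; rewrite -dvdn_prime2 ?(valP p) ?(valP q)//.
have : (val q %| val p ^ n.+1)%N by apply: dvdn_trans qp; rewrite dvdn_exp.
by rewrite Euclid_dvdX ?(valP q)// => /andP[].
Qed.

(** Chinese remainders, splitting off the full power of one prime at a time. *)
Lemma exists_represents alpha N : (0 < N)%N -> exists a, represents alpha N a.
Proof.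
elim/ltn_ind: N => N IH N0.
have [N1|N1] := leqP N 1.
  exists 0%N => p n; have -> : N = 1%N by apply/eqP; rewrite eqn_leq N1.
  by rewrite dvdn1 => /eqP E; have := ppow_gt1 p n; rewrite E.
pose p : prime_number := exist _ (pdiv N) (pdiv_prime N1).
have pN : (val p %| N)%N by exact: pdiv_dvd.
have : (0 < logn (val p) N)%N by rewrite logn_gt0 mem_primes (valP p) N0.
case E: (logn (val p) N) => [//|k] _.
have NE : N = (val p ^ k.+1 * N`_(val p)^')%N by rewrite -E -p_part partnC.
set M := (N`_(val p)^')%N in NE.
have cop : coprime (val p ^ k.+1) M.
  by rewrite -E -p_part coprime_partC.
have [|a ra] := IH M _ (part_gt0 _ _).
  by rewrite [X in (_ < X)%N]NE ltn_Pmull ?ppow_gt1 ?part_gt0.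
exists (chinese (val p ^ k.+1) M (padic_res (alpha p) k) a) => q n.
have [pq|npq] := eqVneq p q.
  subst q => pn; have pk : (val p ^ n.+1 %| val p ^ k.+1)%N.
    by rewrite dvdn_Pexp2l ?prime_gt1 ?(valP p)// -E -pfactor_dvdn// (valP p).
  rewrite -(modn_dvdm (chinese _ _ _ _) pk) chinese_modl// modn_dvdm//.
  exact: represents_prime pk.
rewrite NE Gauss_dvdr => [qM|]; last first.
  rewrite coprimeXl// coprimeXr// prime_coprime ?(valP q)//.
  rewrite dvdn_prime2 ?(valP q) ?(valP p)//.
  by apply: contra npq => /eqP/val_inj ->.
by rewrite -(modn_dvdm (chinese _ _ _ _) qM) chinese_modr// modn_dvdm// (ra q n qM).
Qed.

Lemma representsD alpha beta N a b : represents alpha N a ->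
  represents beta N b -> represents (alpha + beta) N (a + b).
Proof.
move=> ra rb p n pn; rewrite [RHS]padic_resD.
by rewrite -modnDm (ra p n pn) (rb p n pn) modnDm.
Qed.

Lemma representsM alpha beta N a b : represents alpha N a ->
  represents beta N b -> represents (alpha * beta) N (a * b).
Proof.
move=> ra rb p n pn; rewrite [RHS]padic_resM.
by rewrite -modnMm (ra p n pn) (rb p n pn) modnMm.
Qed.

End Represents.

(** The action is made total, with value [0] on elements of infinite order, so
    that it needs no proof that the group is periodic. *)
Definition jact (alpha : Jring) (G : zmodType) (x : G) : G :=
  xget 0 [set y | exists N a, [/\ (0 < N)%N, x *+ N = 0, represents alpha N a
    & y = x *+ a]].

Lemma mulrn_mod (G : zmodType) (x : G) N a b :
  x *+ N = 0 -> (a = b %[mod N])%N -> x *+ a = x *+ b.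
Proof.
move=> xN ab; rewrite (divn_eq a N) (divn_eq b N) ab !mulrnDr.
by rewrite ![(_ * N)%N]mulnC !mulrnA xN !mul0rn.
Qed.

Section Jact.
Implicit Types (alpha beta : Jring) (G : zmodType).

(** Two representatives, for periods [N] and [N'] of [x], are compared through a
    representative for [N * N']. *)
Lemma jactE alpha G (x : G) N a : (0 < N)%N -> x *+ N = 0 ->
  represents alpha N a -> jact alpha x = x *+ a.
Proof.
move=> N0 xN ra; rewrite /jact; case: xgetP; last first.
  by move/(_ (x *+ a)); case; exists N, a.
move=> _ _ [N' [a' [N'0 xN' ra' ->]]].
have NN0 : (0 < N * N')%N by rewrite muln_gt0 N0.
have [c rc] := exists_represents alpha NN0.
have rcN : represents alpha N c by apply: represents_dvd rc; rewrite dvdn_mulr.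
have rcN' : represents alpha N' c by apply: represents_dvd rc; rewrite dvdn_mull.
rewrite (mulrn_mod xN (represents_unique N0 ra rcN)).
by rewrite (mulrn_mod xN' (represents_unique N'0 ra' rcN')).
Qed.

Lemma jact_torsion alpha G (x : G) N : (0 < N)%N -> x *+ N = 0 ->
  exists2 a, represents alpha N a & jact alpha x = x *+ a.
Proof.
move=> N0 xN; have [a ra] := exists_represents alpha N0.
by exists a => //; exact: jactE ra.
Qed.

Lemma jact_infinite alpha G (x : G) : x \notin torsion G -> jact alpha x = 0.
Proof.
move=> /negP nx; rewrite /jact; case: xgetP => [y _ [N [a [N0 xN _ _]]]|//].
by case: nx; apply/torsionP; exists N.
Qed.

Lemma jact_prime alpha G (x : G) (p : prime_number) n : x *+ (val p ^ n.+1) = 0 ->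
  jact alpha x = x *+ padic_res (alpha p) n.
Proof. by move=> xp; exact: jactE (ppow_gt0 _ _) xp (@represents_prime _ _ _). Qed.

Lemma common_period G (x y : G) : x \in torsion G -> y \in torsion G ->
  exists N, [/\ (0 < N)%N, x *+ N = 0 & y *+ N = 0].
Proof.
move=> /torsionP[m m0 xm] /torsionP[n n0 yn]; exists (m * n)%N.
by rewrite muln_gt0 m0 n0 mulrnA xm mul0rn mulnC mulrnA yn mul0rn.
Qed.

Lemma jactB alpha G (x y : G) : x \in torsion G -> y \in torsion G ->
  jact alpha (x - y) = jact alpha x - jact alpha y.
Proof.
move=> xt yt; have [N [N0 xN yN]] := common_period xt yt.
have [a ra] := exists_represents alpha N0.
by rewrite !(jactE N0 _ ra) ?mulrnBl ?xN ?yN ?subrr.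
Qed.

Lemma jact0 alpha G : jact alpha (0 : G) = 0.
Proof. by rewrite -{1}(subrr 0) jactB ?rpred0// subrr. Qed.

Lemma jact_morph alpha G G' (g : {additive G -> G'}) x : x \in torsion G ->
  jact alpha (g x) = g (jact alpha x).
Proof.
move=> /torsionP[N N0 xN]; have [a ra ->] := jact_torsion alpha N0 xN.
by rewrite (jactE N0 _ ra) -raddfMn ?xN ?raddf0.
Qed.

Lemma jact_mulrn alpha G (x : G) k : x \in torsion G ->
  jact alpha (x *+ k) = jact alpha x *+ k.
Proof.
move=> /torsionP[N N0 xN]; have [a ra ->] := jact_torsion alpha N0 xN.
have xkN : x *+ k *+ N = 0 by rewrite mulrnAC xN mul0rn.
by rewrite (jactE N0 xkN ra) mulrnAC.
Qed.

Lemma jactD_scalar alpha beta G (x : G) :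
  jact (alpha + beta) x = jact alpha x + jact beta x.
Proof.
case: (boolP (x \in torsion G)) => [/torsionP[N N0 xN]|xt]; last first.
  by rewrite !jact_infinite// addr0.
have [a ra ->] := jact_torsion alpha N0 xN.
have [b rb ->] := jact_torsion beta N0 xN.
by rewrite (jactE N0 xN (representsD ra rb)) mulrnDr.
Qed.

Lemma jactB_scalar alpha beta G (x : G) :
  jact (alpha - beta) x = jact alpha x - jact beta x.
Proof. by apply/eqP; rewrite eq_sym subr_eq -jactD_scalar subrK. Qed.

Lemma jactM_scalar alpha beta G (x : G) :
  jact (alpha * beta) x = jact alpha (jact beta x).
Proof.
case: (boolP (x \in torsion G)) => [xt|xt]; last first.
  by rewrite !(jact_infinite _ xt) jact0.
have /torsionP[N N0 xN] := xt.
have [a ra E] := jact_torsion alpha N0 xN.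
have [b rb ->] := jact_torsion beta N0 xN.
by rewrite (jactE N0 xN (representsM ra rb)) jact_mulrn// E mulrnA.
Qed.

Lemma jact0_scalar G (x : G) : jact 0 x = 0.
Proof. by rewrite -(subrr (0 : Jring)) jactB_scalar subrr. Qed.

End Jact.

(** * Endomorphisms that are multiplications up to finite groups *)

(** Packages a predicate known to be closed only inside a proof. *)
Lemma exists_subgroup (A : zmodType) (S : A -> bool) : zmod_closed S ->
  exists H : zmodClosed A, forall x, (x \in H) = S x.
Proof.
move=> SB; pose m := GRing.isZmodClosed.Build A S SB.
by exists (HB.pack_for (zmodClosed A) S m).
Qed.

(** By Bezout's identity, an element of finite order mod [F] is a combination of
    multiples of itself whose orders mod [F] are prime powers. *)
Lemma primary_ind (G : zmodType) (F : zmodClosed G) (P : G -> Prop) :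
    (forall u v, P u -> P v -> P (u - v)) ->
  forall N x, (0 < N)%N -> x *+ N \in F ->
    (forall (p : prime_number) n k, x *+ k *+ (val p ^ n.+1) \in F -> P (x *+ k)) ->
  P x.
Proof.
move=> PB; elim/ltn_ind=> N IH x N0 xN Px.
have [N1|N1] := leqP N 1.
  have NE : N = 1%N by apply/eqP; rewrite eqn_leq N1.
  (* Here [x] is in [F]; any prime will do. *)
  have p2 : prime 2 by [].
  rewrite -[x]mulr1n; apply: (Px (exist _ 2 p2) 0%N 1%N) => /=.
  by rewrite NE mulr1n in xN; rewrite mulr1n expn1 rpredMn.
pose p : prime_number := exist _ (pdiv N) (pdiv_prime N1).
have pN : (val p %| N)%N by exact: pdiv_dvd.
have : (0 < logn (val p) N)%N by rewrite logn_gt0 mem_primes (valP p) N0.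
case E: (logn (val p) N) => [//|k] _.
have NE : N = (val p ^ k.+1 * N`_(val p)^')%N by rewrite -E -p_part partnC.
set M := (N`_(val p)^')%N in NE.
have M0 : (0 < M)%N by exact: part_gt0.
have cop : coprime (val p ^ k.+1) M by rewrite -E -p_part coprime_partC.
case: (egcdnP M (ppow_gt0 p k.+1)) => u v uv _.
have {uv}-> : x = x *+ (u * val p ^ k.+1) - x *+ (v * M).
  by rewrite uv (eqP cop) addn1 mulrSr addrC addKr.
apply: PB; last first.
  apply: (Px p k); rewrite -mulrnA -mulnA mulnC [(M * _)%N]mulnC -NE mulrnA.
  exact: rpredMn.
apply: (IH M) => //.
- by rewrite [X in (_ < X)%N]NE ltn_Pmull ?ppow_gt1.
- by rewrite -mulrnA -mulnA mulnC -NE mulrnA rpredMn.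
- by move=> q n l; rewrite -[x *+ _ *+ _]mulrnA; exact: Px.
Qed.

(** By the pigeonhole principle, two multiples of [x] agree mod [H]. *)
Lemma finite_index_period (A : zmodType) (H : zmodClosed A) x :
  finite_index H [set: A] -> exists2 k, (0 < k)%N & x *+ k \in H.
Proof.
move=> fin; apply: contrapT => nk; apply: infinite_nat.
have inj : {in [set: nat] &, injective (fun n => \pi_({quot H}) (x *+ n))}.
  move=> m n _ _; wlog mn : m n / (m < n)%N.
    move=> h; have [mn|mn|//] := ltngtP m n; first exact: h.
    by move=> /esym hh; apply/esym/h.
  move=> mnE; have : x *+ n - x *+ m \in H by apply/quot_eqP; exact: esym mnE.
  rewrite -mulrnBr ?(ltnW mn)// => xH.
  by case: nk; exists (n - m)%N; rewrite ?subn_gt0.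
rewrite -(eq_finite_set (inj_card_eq inj)).
by apply: sub_finite_set fin => _ [n _ <-]; exists (x *+ n).
Qed.

Lemma subrBB (V : zmodType) (a b c d : V) : (a - b) - (c - d) = (a - c) - (b - d).
Proof. by rewrite !opprB addrACA [RHS]addrACA [- b - c]addrC. Qed.

Section Deviation.
Variables (A : zmodType) (F : zmodClosed A).

(** Its values measure the failure of [f] to act on A/F as [alpha]; when A/F is
    periodic it is additive in [x]. *)
Definition deviation (f : endo A) (alpha : Jring) (x : A) : {quot F} :=
  \pi_({quot F}) (f x) - jact alpha (\pi_({quot F}) x).

Lemma deviationE f alpha N a x : (0 < N)%N -> x *+ N \in F ->
  represents alpha N a -> deviation f alpha x = \pi_({quot F}) (f x - x *+ a).
Proof.
move=> N0 xN ra; rewrite /deviation (jactE N0 _ ra).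
  by rewrite quot_piB -(raddfMn \pi_({quot F})).
by apply/quot_torsion.
Qed.

Lemma deviation_subr f g alpha beta x :
  deviation (f - g) (alpha - beta) x = deviation f alpha x - deviation g beta x.
Proof.
rewrite /deviation jactB_scalar.
have -> : (f - g) x = f x - g x by [].
by rewrite quot_piB subrBB.
Qed.

Hypothesis perF : periodic {quot F}.

Lemma quot_is_torsion (q : {quot F}) : q \in torsion {quot F}.
Proof. exact/torsionP/perF. Qed.

Lemma deviation_is_additive f alpha : zmod_morphism (deviation f alpha).
Proof.
move=> x y; rewrite /deviation (raddfB f) !quot_piB jactB ?quot_is_torsion//.
exact: subrBB.
Qed.

(** From the splitting f g - alpha beta = (f - alpha) g + alpha (g - beta). *)
Lemma deviation_mul f g alpha beta x :
  deviation (f * g) (alpha * beta) x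
  = deviation f alpha (g x) + jact alpha (deviation g beta x).
Proof.
rewrite /deviation jactM_scalar jactB ?quot_is_torsion//.
by rewrite addrA subrK.
Qed.

(** This replaces the invariant subgroup A0 of finite index on which [f] acts as
    [alpha]: any such A0 is contained in the kernel of the deviation. *)
Definition almost_acts (f : endo A) (alpha : Jring) :=
  (forall x, x \in F -> f x = 0) /\ finite_set (range (deviation f alpha)).

(** Every element has a multiple in [F], which [f] kills. *)
Lemma image_torsion (f : endo A) x : (forall x, x \in F -> f x = 0) -> f x \in torsion A.
Proof.
move=> fF; have [k k0 xk] := (periodic_quotP F).1 perF x.
by apply/torsionP; exists k => //; rewrite -raddfMn fF.
Qed.

Lemma almost_actsB f g alpha beta :
  almost_acts f alpha -> almost_acts g beta -> almost_acts (f - g) (alpha - beta).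
Proof.
move=> [fF finf] [gF fing]; split.
  by move=> x xF; have -> : (f - g) x = f x - g x by []; rewrite fF ?gF ?subrr.
apply: sub_finite_set (finite_image2 (fun u v => u - v) finf fing) => _ [x _ <-].
rewrite deviation_subr.
by exists (deviation f alpha x); [exists x|exists (deviation g beta x); [exists x|]].
Qed.

Lemma almost_actsM f g alpha beta :
  almost_acts f alpha -> almost_acts g beta -> almost_acts (f * g) (alpha * beta).
Proof.
move=> [fF finf] [gF fing]; split.
  by move=> x xF; have -> : (f * g) x = f (g x) by []; rewrite gF ?raddf0.
apply: sub_finite_set (finite_image2 (fun u v => u + jact alpha v) finf fing).
move=> _ [x _ <-]; rewrite deviation_mul.
exists (deviation f alpha (g x)); first by exists (g x).
by exists (deviation g beta x); first by exists x.
Qed.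

Lemma acts_deviation (f : endo A) (A0 : zmodClosed A) alpha x :
    {subset F <= A0} -> (forall x, x \in F -> f x = 0) -> acts_as f A0 F alpha ->
  x \in A0 -> deviation f alpha x = 0.
Proof.
move=> FA fF fA xA; have [N N0 xN] := (periodic_quotP F).1 perF x.
apply: (@primary_ind _ F (fun x => deviation f alpha x = 0)) N0 xN _.
  by move=> u v u0 v0; rewrite deviation_is_additive u0 v0 subrr.
move=> p n k xp; rewrite (deviationE f (ppow_gt0 p n.+1) xp (@represents_prime _ _ _)).
by apply/quot_eq0; apply: fA => //; rewrite rpredMn.
Qed.

(** The deviation vanishes on [A0], so it factors through the finite group
    A/A0. *)
Lemma acts_almost (f : endo A) (A0 : zmodClosed A) alpha :
    finite_index A0 [set: A] -> {subset F <= A0} ->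
    (forall x, x \in F -> f x = 0) -> acts_as f A0 F alpha ->
  almost_acts f alpha.
Proof.
move=> fin FA fF fA; split=> //.
apply: sub_finite_set (finite_image (fun q => deviation f alpha (repr q)) fin).
move=> _ [x _ <-]; exists (\pi_({quot A0}) x); first by exists x.
apply/eqP; rewrite -subr_eq0 -deviation_is_additive; apply/eqP.
by apply: acts_deviation FA fF fA _; apply/quot_eqP; rewrite reprK.
Qed.

End Deviation.

Section ChangeOfF.
Variables (A : zmodType) (F K : zmodClosed A).
Hypotheses (KF : {subset K <= F}) (perK : periodic {quot K}).

Lemma periodic_quotS : periodic {quot F}.
Proof.
apply/periodic_quotP => x; have [k k0 xk] := (periodic_quotP K).1 perK x.
by exists k => //; exact: KF.
Qed.

(** The projection from A/K to A/F is evaluated on representatives. *)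
Lemma deviation_lift (f : endo A) alpha x : (forall x, x \in K -> f x = 0) ->
  deviation F f alpha x = \pi_({quot F}) (repr (deviation K f alpha x)).
Proof.
move=> fK; have [N N0 xN] := (periodic_quotP K).1 perK x.
have [a ra] := exists_represents alpha N0.
rewrite (deviationE f N0 xN ra) (deviationE f N0 (KF xN) ra).
by apply/quot_eqP/KF/quot_eqP; rewrite reprK.
Qed.

(** The deviation in A/F is the image of the one in A/K under the projection,
    whose kernel F/K is finite. *)
Lemma almost_actsS (f : endo A) alpha : finite_set (\pi_({quot K}) @` [set` F]) ->
    (forall x, x \in F -> f x = 0) ->
  almost_acts F f alpha <-> almost_acts K f alpha.
Proof.
move=> finF fF; have fK x : x \in K -> f x = 0 by move=> /KF/fF.
split=> -[_ fin]; split=> //; last first.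
  have := finite_image (fun q => \pi_({quot F}) (repr q)) fin.
  apply: sub_finite_set => _ [x _ <-]; rewrite deviation_lift//.
  by exists (deviation K f alpha x); first by exists x.
apply: (@finite_extension _ _ _ (deviation F f alpha)) => //.
- exact/deviation_is_additive/periodic_quotS.
- exact: deviation_is_additive.
apply: sub_finite_set finF => _ [x [_ x0] <-].
have [N N0 xN] := (periodic_quotP K).1 perK x.
have [a ra] := exists_represents alpha N0.
exists (f x - x *+ a); last by rewrite (deviationE f N0 xN ra).
by apply/quot_eq0; rewrite -(deviationE f N0 (KF xN) ra).
Qed.

End ChangeOfF.

(** * Uniform endomorphisms *)

Section Uniform.
Variable A : zmodType.
Implicit Types (f g : endo A) (F K : zmodClosed A).

(** [alpha] is not determined by [f]; it is so modulo the elements of J that act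
    with finite image, and this is the correspondence between UI(A) and H(A). *)
Definition uniform_by f (alpha : Jring) :=
  exists F, [/\ free_fg F, periodic {quot F} & almost_acts F f alpha].

(** With [F] finitely generated, inertiality is automatic: up to finitely many
    cosets, [f y] lies in [y *+ a + F] for [y] in [H], hence its class mod [H]
    is a torsion element of the image of [F] in A/H. *)
Lemma almost_acts_inertial F f alpha :
  free_fg F -> periodic {quot F} -> almost_acts F f alpha -> inertial f.
Proof.
move=> [m [b [_ bF]]] perF [fF fin] H.
suff : finite_set ((\pi_({quot H}) \o f) @` [set` H]).
  apply: sub_finite_set => _ [_ [x xH [y yH <-]] <-]; exists y => //.
  by apply/quot_eqP; rewrite opprD addrCA subrr addr0 rpredN.
apply: (@finite_extension _ _ _ (deviation F f alpha)).
- exact: deviation_is_additive.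
- by move=> x y /=; rewrite (raddfB f) quot_piB.
- by move=> x y; exact: rpredB.
- by apply: sub_finite_set fin => _ [x _ <-]; exists x.
apply: sub_finite_set (finite_torsion_zspan (\pi_({quot H}) \o b)).
move=> _ [y [yH y0] <-] /=; have [N N0 yN] := (periodic_quotP F).1 perF y.
have [a ra] := exists_represents alpha N0; split; last first.
  apply/torsionP; exists N => //; apply/quot_torsion.
  by rewrite -raddfMn fF ?rpred0.
have : f y - y *+ a \in F by apply/quot_eq0; rewrite -(deviationE f N0 yN ra).
rewrite bF => /zspanP[c fyc].
have -> : \pi_({quot H}) (f y) = \pi_({quot H}) (f y - y *+ a).
  by apply/quot_eqP; rewrite opprB addrCA subrr addr0 rpredMn.
rewrite fyc; apply/zspanP; exists c; rewrite raddf_sum; apply: eq_bigr => i _.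
by rewrite raddfMz.
Qed.

(** The kernel of the deviation serves as the subgroup A0. *)
Lemma uniform_by_uniform f alpha : uniform_by f alpha -> uniform f.
Proof.
move=> [F [freeF perF ff]]; split; first exact: almost_acts_inertial ff.
case: ff => fF fin.
have addD := @deviation_is_additive _ F perF f alpha.
have [|A0 A0P] := @exists_subgroup A (fun x => deviation F f alpha x == 0).
  split; first by rewrite -topredE /= -[X in deviation _ _ _ X](subrr 0) addD subrr.
  by move=> x y /eqP x0 /eqP y0; rewrite -topredE /= addD x0 y0 subrr.
have A0E x : x \in A0 <-> deviation F f alpha x = 0.
  by rewrite A0P; split => /eqP.
have jE x : x \in A0 -> exists N a, [/\ (0 < N)%N, x *+ N \in F,
    represents alpha N a & f x - x *+ a \in F].
  move=> /A0E x0; have [N N0 xN] := (periodic_quotP F).1 perF x.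
  have [a ra] := exists_represents alpha N0; exists N, a; split=> //.
  by apply/quot_eq0; rewrite -(deviationE f N0 xN ra).
have FA0 : {subset F <= A0}.
  move=> x xF; apply/A0E; have /quot_eq0 x0 := xF.
  by rewrite /deviation x0 jact0 fF// raddf0 subrr.
exists F, A0; split; split.
- exact: FA0.
- by move=> x xF; rewrite fF ?rpred0.
- move=> x xA; have [N [a [N0 xN ra fx]]] := jE _ xA.
  have fN : f x *+ N \in F by rewrite -raddfMn fF ?rpred0.
  apply/A0E; by rewrite (deviationE f N0 fN ra) -raddfMn -raddfB fF// !raddf0.
- by apply: (finite_index_kernel addD A0E); exact: fin.
- by move=> x _; have [N N0 xN] := (periodic_quotP F).1 perF x; exists N.
- exists alpha => p n x /A0E x0 xp.
  by apply/quot_eq0; rewrite -(deviationE f (ppow_gt0 p n.+1) xp (@represents_prime _ _ _)).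
- exact: free_fg_abelian.
- exact: fF.
Qed.

Lemma uniformP f : finite_torsionfree_rank A ->
  uniform f <-> exists alpha, uniform_by f alpha.
Proof.
move=> rankA; split=> [[_ [F [A0 [[FA _ _] [fin per [alpha fA] freeF fF]]]]]|[a]];
  last exact: uniform_by_uniform.
have perF : periodic {quot F}.
  apply/periodic_quotP => x; have [k k0 xk] := finite_index_period x fin.
  by have [l l0 xl] := per _ xk; exists (k * l)%N; rewrite ?muln_gt0 ?k0 ?mulrnA.
exists alpha, F; split=> //; first exact: free_abelian_fg.
exact: acts_almost fA.
Qed.

Lemma almost_acts_shrink F K f alpha : free_fg F -> periodic {quot K} ->
  {subset K <= F} -> almost_acts F f alpha -> almost_acts K f alpha.
Proof.
move=> freeF perK KF ff.
by apply/(almost_actsS KF perK) => //; [exact: finite_fg_periodic | case: ff].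
Qed.

Lemma uniform_by_common f g alpha beta :
    uniform_by f alpha -> uniform_by g beta ->
  exists K, [/\ free_fg K, periodic {quot K}, almost_acts K f alpha
    & almost_acts K g beta].
Proof.
move=> [F [freeF perF ff]] [F' [freeF' perF' gg]].
have [K [freeK perK KF KF']] := full_meet freeF perF perF'.
exists K; split=> //; first exact: almost_acts_shrink KF ff.
exact: almost_acts_shrink KF' gg.
Qed.

Lemma uniform_byB f g alpha beta : uniform_by f alpha -> uniform_by g beta ->
  uniform_by (f - g) (alpha - beta).
Proof.
move=> fa gb; have [K [freeK perK fK gK]] := uniform_by_common fa gb.
by exists K; split=> //; exact: almost_actsB.
Qed.

Lemma uniform_byM f g alpha beta : uniform_by f alpha -> uniform_by g beta ->
  uniform_by (f * g) (alpha * beta).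
Proof.
move=> fa gb; have [K [freeK perK fK gK]] := uniform_by_common fa gb.
by exists K; split=> //; exact: almost_actsM.
Qed.

Lemma finitary_kernel f : f \in finitary A ->
  exists H, finite_index H [set: A] /\ forall x, x \in H <-> f x = 0.
Proof.
move=> /asboolP fin; have [|H HP] := @exists_subgroup A (fun x => f x == 0).
  split; first by rewrite -topredE /= raddf0.
  by move=> x y /eqP x0 /eqP y0; rewrite -topredE /= raddfB x0 y0 subrr.
have HE x : x \in H <-> f x = 0 by rewrite HP; split=> /eqP.
exists H; split=> //; apply: finite_index_kernel HE fin; exact: raddfB.
Qed.

(** The kernel of [f] has finite index, so it contains a free subgroup [K] with
    A/K periodic. *)
Lemma finitary_uniform_by f : finite_torsionfree_rank A -> f \in finitary A ->
  uniform_by f 0.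
Proof.
move=> /exists_full[F [freeF perF]] ff.
have [H [finH HE]] := finitary_kernel ff.
have perH : periodic {quot H}.
  by apply/periodic_quotP => x; exact: finite_index_period finH.
have [K [freeK perK KF KH]] := full_meet freeF perF perH.
exists K; split=> //; split; first by move=> x /KH/HE.
move/asboolP: ff => ff.
apply: sub_finite_set (finite_image \pi_({quot K}) ff) => _ [x _ <-].
by exists (f x); [exists x | rewrite /deviation jact0_scalar subr0].
Qed.

(** Choose [K] in [F], adapted to [f]. Since [f] kills [K] its values are torsion
    elements, which are determined by their classes mod [K]; so [f] is finitary
    iff its composite with the projection to A/K has finite image. That
    composite differs from the action of [alpha] by the deviation. *)
Lemma uniform_by_finitary f alpha F :
    uniform_by f alpha -> free_fg F -> periodic {quot F} ->
  f \in finitary A <-> almost_acts F 0 alpha.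
Proof.
move=> [F' [freeF' perF' ff]] freeF perF.
have [K [freeK perK KF KF']] := full_meet freeF perF perF'.
have fK : almost_acts K f alpha by exact: almost_acts_shrink KF' ff.
have [fK0 finK] := fK.
have finF := finite_fg_periodic freeF perK.
apply: iff_trans (iff_sym (@almost_actsS _ F K KF perK 0 alpha finF (fun _ _ => erefl))).
split=> [/asboolP fin|[_ fin]]; last first.
  apply/asboolP; apply: (@finite_extension _ _ _ (\pi_({quot K}) \o f)) => //.
  - by move=> x y /=; rewrite raddfB quot_piB.
  - exact: raddfB.
  - apply: sub_finite_set (finite_image2 (fun u v => u - v) finK fin).
    move=> _ [x _ <-]; exists (deviation K f alpha x); first by exists x.
    exists (deviation K 0 alpha x); first by exists x.
    by rewrite -deviation_subr subrr /deviation jact0_scalar !subr0.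
  - apply: sub_finite_set (finite_set1 0) => _ [x [_ /quot_eq0 fxK] <-].
    by apply: free_fg_torsion freeK fxK _; apply: image_torsion fK0.
split=> //.
apply: sub_finite_set (finite_image2 (fun u v => u - \pi_({quot K}) v) finK fin).
move=> _ [x _ <-]; exists (deviation K f alpha x); first by exists x.
exists (f x); first by exists x.
by rewrite /deviation raddf0 sub0r addrAC subrr sub0r.
Qed.

End Uniform.

(** * The periodic case *)

Section Periodic.
Variable A : zmodType.

(** In a periodic group the only free subgroup is the trivial one. *)
Lemma exists_trivial : exists O : zmodClosed A, forall x, (x \in O) = (x == 0).
Proof.
apply: (@exists_subgroup A (fun x => x == 0)); split; rewrite -?topredE /=.
  by rewrite eqxx.
by move=> x y /eqP -> /eqP ->; rewrite -topredE /= subrr.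
Qed.

Hypothesis perA : periodic A.

Lemma is_torsion_periodic (x : A) : x \in torsion A.
Proof. exact/torsionP/perA. Qed.

Lemma periodic_rank : finite_torsionfree_rank A.
Proof.
exists 0%N => m x ix; case: m x ix => // m x ix; exfalso.
have [n n0 xn] := perA (repr (x ord0)).
have xn0 : x ord0 = 0.
  by rewrite -[x ord0]reprK; apply/quot_eq0; exact: is_torsion_periodic.
have /ix/(_ ord0) : \sum_i x i *~ (i == ord0)%:Z = 0.
  rewrite (bigD1 ord0)//= xn0 mul0rz add0r big1// => i /negPf ->.
  by rewrite mulr0z.
by rewrite eqxx.
Qed.

Variable (O : zmodClosed A).
Hypothesis OE : forall x, (x \in O) = (x == 0).

Lemma trivial_free : free_fg O.
Proof.
exists 0%N, (fun=> 0); split; first by move=> c _ [].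
move=> y; rewrite OE; apply/eqP/zspanP => [->|[c ->]]; last by rewrite big_ord0.
by exists (fun=> 0); rewrite big_ord0.
Qed.

Lemma trivial_periodic : periodic {quot O}.
Proof.
apply/periodic_quotP => x; have [n n0 xn] := perA x.
by exists n => //; rewrite OE xn.
Qed.

Fact jact_is_additive alpha : zmod_morphism (@jact alpha A).
Proof. by move=> x y; rewrite jactB ?is_torsion_periodic. Qed.

Lemma exists_multiplication alpha : exists f : endo A, f =1 @jact alpha A.
Proof.
pose m := GRing.isZmodMorphism.Build A A (@jact alpha A) (jact_is_additive alpha).
by exists (HB.pack_for {additive A -> A} (@jact alpha A) m).
Qed.

Lemma multiplication_uniform_by alpha (f : endo A) :
  f =1 @jact alpha A -> uniform_by f alpha.
Proof.
move=> fE; exists O; split; [exact: trivial_free | exact: trivial_periodic |].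
split; first by move=> x; rewrite OE => /eqP ->; rewrite raddf0.
apply: sub_finite_set (finite_set1 0) => _ [x _ <-].
by rewrite /deviation jact_morph ?is_torsion_periodic// fE subrr.
Qed.

Lemma multiplications_jact (f : endo A) :
  multiplications A f <-> exists alpha, f =1 @jact alpha A.
Proof.
split=> -[alpha fA]; exists alpha; last first.
  by move=> p n x _ /eqP xp; apply/eqP; rewrite fA (jact_prime alpha xp) subrr.
move=> x; have [N N0 xN] := perA x.
apply: (@primary_ind A O (fun x => f x = jact alpha x)) N0 _ _.
- by move=> u v fu fv; rewrite raddfB fu fv jactB ?is_torsion_periodic.
- by rewrite OE xN.
move=> p n k; rewrite OE => /eqP xp; rewrite (jact_prime alpha xp).
have /eqP : f (x *+ k) - x *+ k *+ padic_res (alpha p) n \in pred1 0.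
  by apply: fA => //; apply/eqP.
by move/eqP; rewrite subr_eq0 => /eqP.
Qed.

(** If [f] is related to [alpha] then its difference with the multiplication by
    [alpha] is related to 0, hence finitary. *)
Lemma uniform_multiplication_finitary (f : endo A) : UI A f ->
  [set f + g | f in multiplications A & g in [set` finitary A]] f.
Proof.
move=> /(uniformP f periodic_rank)[alpha fa].
have [m mE] := exists_multiplication alpha.
have ma := multiplication_uniform_by mE.
exists m; first by apply/multiplications_jact; exists alpha.
exists (f - m); last by rewrite addrC subrK.
apply/(uniform_by_finitary (uniform_byB fa ma) trivial_free trivial_periodic).
rewrite subrr; split=> //.
apply: sub_finite_set (finite_set1 0) => _ [x _ <-].
by rewrite /deviation jact0_scalar raddf0 subr0.
Qed.

(** The sum is a multiplication on the kernel of its finitary part; this kernel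
    is invariant since multiplications leave every subgroup invariant. *)
Lemma multiplication_finitary_FM (f : endo A) :
    [set f + g | f in multiplications A & g in [set` finitary A]] f ->
  finitary_multiplications A f.
Proof.
move=> [m mM [g gF <-]]; have [H [finH HE]] := finitary_kernel gF.
have /multiplications_jact[alpha mE] := mM.
have mgE x : x \in H -> (m + g) x = jact alpha x.
  by move=> /HE gx; have -> : (m + g) x = m x + g x by []; rewrite gx addr0 mE.
exists H; split=> //.
  move=> x xH; rewrite mgE//; apply/HE; have [N N0 xN] := perA x.
  have [a _ ->] := jact_torsion alpha N0 xN.
  by rewrite raddfMn; move/HE: xH => ->; rewrite mul0rn.
exists alpha => p n x xH /eqP xp; apply/eqP.
by rewrite mgE// (jact_prime alpha xp) subrr.
Qed.

Lemma FM_uniform (f : endo A) : finitary_multiplications A f -> UI A f.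
Proof.
move=> [A0 [fin _ [alpha fA]]]; apply/(uniformP f periodic_rank).
have fO x : x \in O -> f x = 0 by rewrite OE => /eqP ->; rewrite raddf0.
exists alpha, O; split; [exact: trivial_free | exact: trivial_periodic |].
apply: (acts_almost trivial_periodic fin _ fO) => [x|p n x xA].
  by rewrite OE => /eqP ->; rewrite rpred0.
by rewrite !OE; exact: fA.
Qed.

End Periodic.

(** * Multiples of powers of p in the p-adic integers *)

Section PadicDivision.
Variable p : prime_number.
Implicit Types a y : padic p.

Lemma padic_res_mulX y k n :
  (padic_res (y * (val p)%:R ^+ k)%R n = padic_res y n * val p ^ k %[mod val p ^ n.+1])%N.
Proof. by rewrite padic_resM -modnMmr padic_resX modnMmr. Qed.

(** Divide the residues, shifted by [k] to keep enough precision. *)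
Lemma padic_div a k : (val p ^ k %| padic_res a k)%N -> exists y, a = y * (val p)%:R ^+ k.
Proof.
move=> ak.
have akn n : (val p ^ k %| padic_res a (n + k))%N.
  have d : (val p ^ k %| val p ^ k.+1)%N by rewrite dvdn_exp2l.
  by rewrite /dvdn -(modn_dvdm _ d) padic_res_coherent ?leq_addl// modn_dvdm.
have [n|y yE] := @exists_padic p (fun n => padic_res a (n + k) %/ val p ^ k)%N.
  apply/eqP; rewrite -(eqn_pmul2r (ppow_gt0 p k)) !muln_modl -expnD !divnK//.
  by rewrite addSn; apply/eqP; apply: padic_res_coherent; rewrite leqnSn.
exists y; apply: padic_eq => n.
rewrite -(modn_small (padic_res_ltn a n)) -(modn_small (padic_res_ltn (y * _) n)).
rewrite padic_res_mulX yE modnMml divnK//.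
by rewrite [RHS]padic_res_coherent ?leq_addr.
Qed.

(** The exponent is the index of the first nonzero residue. Being a unit is
    recorded as having a first residue prime to p. *)
Lemma padic_unit_part a : a != 0 ->
  exists k y, a = y * (val p)%:R ^+ k /\ ~~ (val p %| padic_res y 0)%N.
Proof.
move=> a0; have ex : exists n, padic_res a n != 0%N.
  apply: contrapT => na; case/eqP: a0; apply: padic_eq => n; rewrite padic_res0.
  by apply/eqP/negPn/negP => an; apply: na; exists n.
case: (ex_minnP ex) => k ak kmin.
have [|y yE] := @padic_div a k.
  case: k ak kmin => [|k] ak kmin; first exact: dvd1n.
  have /eqP a0k : padic_res a k == 0%N.
    by apply/negPn/negP => /kmin; rewrite ltnn.
  by rewrite /dvdn padic_res_coherent// a0k mod0n.
exists k, y; split=> //; apply: contra ak => py.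
rewrite -(modn_small (padic_res_ltn a k)) yE padic_res_mulX.
rewrite expnS -[_ == _]/(_ %| _)%N dvdn_mul// /dvdn -[val p]expn1.
by rewrite (padic_res_coherent y (leq0n k)) expn1.
Qed.

End PadicDivision.

(** A p-adic integer acts on p-groups through any element of J that has it as a
    component. *)
Lemma exists_component (p : prime_number) (y : padic p) :
  exists beta : Jring, beta p = y.
Proof.
exists (fun q => if pselect (p = q) is left e then eq_rect p padic y q e else 0).
by case: pselect => // e; rewrite (Prop_irrelevance e erefl).
Qed.

(** * The action of J on a periodic group, one prime at a time *)

Section PrimaryAction.
Variables (Q : zmodType) (p : prime_number).
Implicit Types (alpha beta : Jring) (x : Q).

Definition primary x := exists k, x *+ (val p ^ k) = 0.

Lemma primary_pow x : primary x -> exists n, x *+ (val p ^ n.+1) = 0.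
Proof. by move=> [k xk]; exists k; rewrite expnSr mulrnA xk mul0rn. Qed.

Lemma primary_torsion x : primary x -> x \in torsion Q.
Proof. by move=> [k xk]; apply/torsionP; exists (val p ^ k)%N => //; exact: ppow_gt0. Qed.

Lemma primaryB x y : primary x -> primary y -> primary (x - y).
Proof.
move=> [k xk] [l yl]; exists (k + l)%N.
by rewrite mulrnBl expnD mulrnA xk mul0rn mulnC mulrnA yl mul0rn subrr.
Qed.

Lemma primary_jact alpha x : primary x -> primary (jact alpha x).
Proof.
by move=> /[dup] /primary_torsion xt [k xk]; exists k; rewrite -jact_mulrn// xk jact0.
Qed.

Lemma jact_component alpha beta k x : primary x ->
  alpha p = beta p * (val p)%:R ^+ k -> jact alpha x = jact beta x *+ val p ^ k.
Proof.
move=> /primary_pow[n xn] ab; rewrite (jact_prime alpha xn) (jact_prime beta xn) ab.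
by rewrite -mulrnA; apply: mulrn_mod xn _; exact: padic_res_mulX.
Qed.

Lemma jact_component0 alpha x : primary x -> alpha p = 0 -> jact alpha x = 0.
Proof.
move=> px a0; have [n xn] := primary_pow px.
by rewrite (jact_prime alpha xn) a0 padic_res0.
Qed.

(** A unit residue is invertible modulo the order of [x]. *)
Lemma jact_unit_inj alpha x : ~~ (val p %| padic_res (alpha p) 0)%N ->
  primary x -> jact alpha x = 0 -> x = 0.
Proof.
move=> pa /primary_pow[n xn]; rewrite (jact_prime alpha xn) => x0.
have cop : coprime (padic_res (alpha p) n) (val p ^ n.+1).
  rewrite coprimeXr// coprime_sym prime_coprime ?(valP p)//.
  move: pa; rewrite /dvdn -[val p]expn1.
  by rewrite -(padic_res_coherent (alpha p) (leq0n n)).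
case: (egcdnP (padic_res (alpha p) n) (ppow_gt0 p n.+1)) => u v uv _.
have := congr1 (fun k => x *+ k) uv; rewrite /= gcdnC (eqP cop) mulrnDr mulr1n.
by rewrite [(u * _)%N]mulnC [(v * _)%N]mulnC !mulrnA xn x0 !mul0rn add0r => ->.
Qed.

(** The unit factor acts injectively on the p-component, so that [alpha] and p^k
    have the same kernel there and images of the same size. *)
Lemma jact_unit_part alpha : alpha p != 0 ->
  exists k y, [/\ alpha p = y * (val p)%:R ^+ k,
    forall x, primary x -> (jact alpha x = 0 <-> x *+ (val p ^ k) = 0)
    & periodic Q -> finite_set (@jact alpha Q @` primary) ->
      finite_set [set x *+ (val p ^ k) | x in primary]].
Proof.
move=> /padic_unit_part[k [y [ay py]]]; exists k, y.
have [beta by_] := exists_component y.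
have kill x : primary x -> jact alpha x = 0 <-> x *+ (val p ^ k) = 0.
  move=> px; have xt := primary_torsion px.
  rewrite (@jact_component alpha beta k)// ?by_// -jact_mulrn//.
  split=> [|->]; last exact: jact0.
  apply: jact_unit_inj; rewrite ?by_//.
  by case: px => l xl; exists l; rewrite mulrnAC xl mul0rn.
split=> // perQ fin; apply: (@finite_extension _ _ _ (@jact alpha Q)) => //.
- exact: jact_is_additive.
- by move=> u v; rewrite mulrnBl.
- exact: primaryB.
- by apply: sub_finite_set (finite_set1 0) => _ [x [px /kill xk] <-]; exact: xk.
Qed.

End PrimaryAction.

(** * The ring H(A) as a quotient of J *)

Lemma least_some (P : nat -> Prop) n : least P = Some n -> P n /\ forall m, P m -> (n <= m)%N.
Proof.
rewrite /least; case: pselect => // ex [<-]; case: ex_minnP => k /asboolP Pk kmin.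
by split=> // m Pm; apply: kmin; apply/asboolP.
Qed.

Lemma least_ex (P : nat -> Prop) m : P m -> exists n, least P = Some n.
Proof.
rewrite /least => Pm; case: pselect => [ex|[]]; first by eexists.
by exists m; apply/asboolP.
Qed.

Lemma padic_idealP (p : prime_number) e (a : padic p) :
  reflect (exists y, a = y * (if e is Some k then (val p)%:R ^+ k else 0))
    (a \in padic_ideal p e).
Proof. exact: asboolP. Qed.

Section PrimaryIdeals.
Variables (A : zmodType) (F : zmodClosed A) (p : prime_number).
Hypothesis perF : periodic {quot F}.
Implicit Types alpha : Jring.
Local Notation Q := {quot F}.
Local Notation Qp := (@primary Q p).

Lemma bound_exp_le k : (forall x : Q, Qp x -> x *+ (val p ^ k) = 0) ->
  exists2 e, bound_exp F p = Some e & (e <= k)%N.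
Proof.
pose P e := forall x : Q, Qp x -> x *+ (val p ^ e) = 0.
move=> Pk; have [e eE] := @least_ex P k Pk.
by exists e => //; exact: (least_some eE).2 k Pk.
Qed.

(** The annihilator of the p-component: if [alpha p] is a unit times p^k, it
    kills the component iff p^k does, iff e_p <= k. *)
Lemma bound_ideal alpha :
  alpha p \in padic_ideal p (bound_exp F p) <->
  forall x : Q, Qp x -> jact alpha x = 0.
Proof.
split=> [/padic_idealP[y ay] x px|kill].
  case E: (bound_exp F p) ay => [e|] ay; last first.
    by apply: jact_component0 px _; rewrite ay mulr0.
  have [beta by_] := exists_component y; rewrite -by_ in ay.
  rewrite (jact_component px ay) -jact_mulrn ?quot_is_torsion//.
  by rewrite ((least_some E).1 x px) jact0.
have [->|a0] := eqVneq (alpha p) 0; first exact: rpred0.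
have [k [y [ay yk _]]] := jact_unit_part Q a0.
have killk x : Qp x -> x *+ (val p ^ k) = 0 by move=> px; apply/yk => //; exact: kill.
have [e -> ek] := bound_exp_le killk; apply/padic_idealP; exists (y * (val p)%:R ^+ (k - e)).
by rewrite -mulrA -exprD subnK.
Qed.

(** Finitely many elements of p-power order have a common annihilator. *)
Lemma finite_primary_bounded k : finite_set [set x *+ (val p ^ k) | x in Qp] ->
  exists e, forall x, Qp x -> x *+ (val p ^ e) = 0.
Proof.
move=> /finite_seqP[s sE].
suff [m ms] : exists m, forall z, z \in s -> z *+ (val p ^ m) = 0.
  exists (k + m)%N => x px; rewrite expnD mulrnA; apply: ms.
  have : [set x *+ (val p ^ k) | x in Qp] (x *+ (val p ^ k)) by exists x.
  by rewrite sE.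
have {sE} sp z : z \in s -> Qp z.
  move=> zs; have : [set` s] z by []; rewrite -sE => -[x [l xl] <-].
  by exists l; rewrite mulrnAC xl mul0rn.
elim: s sp => [|z s IH] sp; first by exists 0%N.
have [|m ms] := IH; first by move=> w ws; apply: sp; rewrite inE ws orbT.
have [l zl] := sp z (mem_head _ _).
exists (l + m)%N => w; rewrite inE expnD => /predU1P[->|/ms wm].
  by rewrite mulrnA zl mul0rn.
by rewrite mulnC mulrnA wm mul0rn.
Qed.

Lemma finite_exp_le k : finite_set [set x *+ (val p ^ k) | x in Qp] ->
  exists2 e, finite_exp F p = Some e & (e <= k)%N.
Proof.
pose P e := finite_set [set x *+ (val p ^ e) | x in Qp].
move=> Pk; have [b /bound_exp_le[e' bE _]] := finite_primary_bounded Pk.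
have [e eE] := @least_ex P k Pk; rewrite /finite_exp bE.
by exists e => //; exact: (least_some eE).2 k Pk.
Qed.

(** The difference [alpha p - y] kills the p-component by [bound_ideal], so
    only [y] matters. If [alpha p] is a unit times p^k, finiteness of its image
    means finiteness of the image of p^k, that is epsilon_p <= k; in particular
    the component is bounded. *)
Lemma finite_ideal alpha :
  (exists2 y, y \in padic_ideal p (finite_exp F p)
     & alpha p - y \in padic_ideal p (bound_exp F p)) <->
  finite_set (@jact alpha Q @` Qp).
Proof.
split=> [[y yfin ybound]|fin].
  have [gamma gy] := exists_component y.
  have kill : forall x : Q, Qp x -> jact (alpha - gamma) x = 0.
    by apply/bound_ideal; rewrite -gy in ybound.
  have aE x : Qp x -> jact alpha x = jact gamma x.
    by move/kill; rewrite jactB_scalar => /eqP; rewrite subr_eq0 => /eqP.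
  move: yfin => /padic_idealP[z yz].
  case E: (finite_exp F p) yz => [e|] yz; last first.
    apply: sub_finite_set (finite_set1 0) => _ [x px <-]; rewrite aE//.
    by apply: jact_component0 px _; rewrite gy yz mulr0.
  have [beta bz] := exists_component z.
  have fine : finite_set [set x *+ (val p ^ e) | x in Qp].
    by move: E; rewrite /finite_exp; case: bound_exp => // b /least_some[].
  apply: sub_finite_set (finite_image (@jact beta Q) fine) => _ [x px <-].
  exists (x *+ (val p ^ e)); first by exists x.
  have gb : gamma p = beta p * (val p)%:R ^+ e by rewrite gy bz.
  by rewrite aE// (jact_component px gb) jact_mulrn ?quot_is_torsion.
have [->|a0] := eqVneq (alpha p) 0.
  by exists 0; rewrite ?subrr; exact: rpred0.
have [k [y [ay _ /(_ perF fin) fink]]] := jact_unit_part Q a0.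
exists (alpha p); last by rewrite subrr; exact: rpred0.
have [e -> fk] := finite_exp_le fink; apply/padic_idealP.
by exists (y * (val p)%:R ^+ (k - e)); rewrite -mulrA -exprD subnK.
Qed.

End PrimaryIdeals.

(** The image of [alpha] is generated by its images on the primary components.
    If only finitely many of these are nonzero and all are finite, it is a
    finitely generated periodic group. Conversely, nonzero elements taken in the
    images for different primes are distinct. *)
Lemma finite_jact (Q : zmodType) alpha : periodic Q ->
  finite_set (range (@jact alpha Q)) <->
  (forall p : prime_number, finite_set (@jact alpha Q @` primary p)) /\
  finite_set [set p : prime_number | exists x : Q, primary p x /\ jact alpha x != 0].
Proof.
move=> perQ; split=> [fin|[finp finP]].
  split=> [p|]; first by apply: sub_finite_set fin => _ [x _ <-]; exists x.
  set P := [set p | _].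
  have pre (p : prime_number) : exists x : Q, P p -> primary p x /\ jact alpha x != 0.
    by have [[x xP]|no] := pselect (P p); [exists x | exists 0].
  have [s sP] := choice pre.
  have inj : {in P &, injective (fun p => jact alpha (s p))}.
    move=> p q /set_mem/sP[ps sp0] /set_mem/sP[qs _] /= pq; apply: contra_neq_eq sp0 => npq.
    have [k sk] := primary_jact alpha ps; have [l sl] := primary_jact alpha qs.
    (* A common value has order dividing powers of two different primes. *)
    have cop : coprime (val p ^ k) (val q ^ l).
      rewrite coprimeXl// coprimeXr// prime_coprime ?(valP p)//.
      by rewrite dvdn_prime2 ?(valP q) ?(valP p)//.
    case: (egcdnP (val q ^ l) (ppow_gt0 p k)) => u v uv _.
    have := congr1 (fun m => jact alpha (s p) *+ m) uv.
    rewrite /= (eqP cop) mulrnDr mulr1n [(u * _)%N]mulnC [(v * _)%N]mulnC !mulrnA sk.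
    by rewrite pq sl !mul0rn add0r => <-.
  rewrite -(eq_finite_set (inj_card_eq inj)).
  by apply: sub_finite_set fin => _ [p _ <-]; exists (s p).
set P := [set p | _] in finP.
have finU : finite_set ([set 0] `|` \bigcup_(p in P) (@jact alpha Q @` primary p)).
  by rewrite finite_setU; split; [exact: finite_set1 | exact: bigcup_finite].
have [t tE] := (finite_seqP _).1 finU.
have tP (i : 'I_(size t)) : exists2 n : nat, (0 < n)%N & t`_i *+ n = 0 by exact: perQ.
apply: sub_finite_set (finite_zspan tP) => _ [x _ <-].
have [N N0 xN] := perQ x; have [O OE] := exists_trivial Q.
apply: (@primary_ind Q O (fun x => jact alpha x \in zspan (fun i : 'I_(size t) => t`_i)))
  N0 _ _.
- by move=> u v us vs; rewrite jactB ?rpredB//; exact: is_torsion_periodic.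
- by rewrite OE xN.
move=> p n k; rewrite OE => /eqP xp; set y := x *+ k.
have py : primary p y by exists n.+1.
have : ([set 0] `|` \bigcup_(p in P) (@jact alpha Q @` primary p)) (jact alpha y).
  have [->|y0] := eqVneq (jact alpha y) 0; first by left.
  by right; exists p; [exists y | exists y].
rewrite tE /= => /(nthP 0)[i it <-].
exact: (mem_zspan (fun i : 'I_(size t) => t`_i) (Ordinal it)).
Qed.

Section Theta.
Variables (A : zmodType) (F : zmodClosed A).
Hypothesis perF : periodic {quot F}.

(** The canonical surjection of J onto H(A). *)
Definition theta (alpha : Jring) : Hring F :=
  factor_pi (Hden F)
    ((fun p => factor_pi (padic_ideal p (bound_exp F p)) (alpha p)) : Hnum F).

Lemma thetaB : zmod_morphism theta.
Proof.
move=> a b; rewrite /theta.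
rewrite -[RHS](raddfB \pi_({quot (Hden F)})); congr (factor_pi _ _).
apply: functional_extensionality_dep => p.
exact: (raddfB \pi_({quot (padic_ideal p (bound_exp F p))})).
Qed.

Lemma thetaM : {morph theta : a b / a * b}.
Proof.
move=> a b; rewrite /theta.
apply: etrans (factor_piM _ _ _); congr (factor_pi _ _).
apply: functional_extensionality_dep => p.
exact: factor_piM.
Qed.

Lemma theta_surj h : exists alpha, theta alpha = h.
Proof.
exists (fun p => repr ((repr h : Hnum F) p)).
rewrite /theta -[RHS]factor_reprK; congr (factor_pi _ _).
by apply: functional_extensionality_dep => p; rewrite factor_reprK.
Qed.

(** For the zero endomorphism the deviation is, up to sign, the action. *)
Lemma almost_acts0 alpha :
  almost_acts F 0 alpha <-> finite_set (range (@jact alpha {quot F})).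
Proof.
split=> [[_ fin]|fin].
  apply: sub_finite_set (finite_image -%R fin) => _ [q _ <-].
  exists (deviation F 0 alpha (repr q)); first by exists (repr q).
  by rewrite /deviation reprK raddf0 sub0r opprK.
split=> //; apply: sub_finite_set (finite_image -%R fin) => _ [x _ <-].
exists (jact alpha (\pi_({quot F}) x)); first by exists (\pi x).
by rewrite /deviation raddf0 sub0r.
Qed.

(** The two conditions of [finite_jact] say that [alpha] lies in the denominator
    of H(A): on each component by [finite_ideal], and with finite support by
    [bound_ideal]. *)
Lemma theta_eq0 alpha :
  theta alpha = 0 <-> finite_set (range (@jact alpha {quot F})).
Proof.
rewrite finite_jact//; apply: iff_trans (quot_eq0 (Hden F) _) _.
have imageE p : factor_pi (padic_ideal p (bound_exp F p)) (alpha p)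
      \in image_ideal (padic_ideal p (bound_exp F p)) (padic_ideal p (finite_exp F p))
    <-> finite_set (@jact alpha {quot F} @` primary p).
  split=> [/asboolP[y yfin yE]|/(finite_ideal p perF)[y yfin yE]].
    by apply/(finite_ideal p perF); exists y => //; apply/factor_piP.
  by apply/asboolP; exists y => //; apply/factor_piP.
have suppE p : factor_pi (padic_ideal p (bound_exp F p)) (alpha p) != 0
    <-> exists x : {quot F}, primary p x /\ jact alpha x != 0.
  split=> [/eqP a0|[x [px x0]]].
    apply: contrapT => nx; apply: a0; apply/quot_eq0/bound_ideal => // x px.
    by apply/eqP/negPn/negP => x0; apply: nx; exists x.
  apply/eqP => /quot_eq0/(bound_ideal _ _)-/(_ perF x px) x00.
  by rewrite x00 eqxx in x0.
have supp : [set p | factor_pi (padic_ideal p (bound_exp F p)) (alpha p) != 0]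
    = [set p | exists x : {quot F}, primary p x /\ jact alpha x != 0].
  by apply/seteqP; split=> p /suppE.
split=> [/asboolP[fin]|[fin finP]].
  by rewrite supp => finP; split=> // p; apply/imageE; exact: fin.
by apply/asboolP; rewrite supp; split=> // p; apply/imageE.
Qed.

End Theta.

(** * Rings related by a correspondence *)

(** A relation between [R] and [J] that is compatible with the ring operations
    and under which [I] corresponds to the kernel of [th] induces an isomorphism
    from a subring of R/I onto a subring of [H]. *)
Section Correspondence.
Variables (R J H : pzRingType) (I : twoSidedIdeal R) (th : J -> H).
Variable rel : R -> J -> Prop.
Hypotheses (thB : zmod_morphism th) (thM : {morph th : a b / a * b}).
Hypotheses (relB : forall x y a b, rel x a -> rel y b -> rel (x - y) (a - b))
  (relM : forall x y a b, rel x a -> rel y b -> rel (x * y) (a * b))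
  (relI : forall x a, rel x a -> (x \in I <-> th a = 0)).

Let dom := [set x | exists a, rel x a].
Let cod := [set th a | a in [set a | exists x, rel x a]].

Lemma correspondence_subring : (exists x a, rel x a) -> subring cod.
Proof.
move=> [z [c zc]]; split.
- by exists (c - c); [exists (z - z); exact: relB | rewrite thB subrr].
- move=> _ _ [a [x xa] <-] [b [y yb] <-].
  by exists (a - b); [exists (x - y); exact: relB | exact: thB].
- move=> _ _ [a [x xa] <-] [b [y yb] <-].
  by exists (a * b); [exists (x * y); exact: relM | exact: thM].
Qed.

Lemma correspondence_eq x y a b : rel x a -> rel y b ->
  factor_pi I x = factor_pi I y <-> th a = th b.
Proof.
move=> xa yb; have xyI := relI (relB xa yb).
rewrite thB in xyI; split=> [/factor_piP/xyI/eqP|ab].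
  by rewrite subr_eq0 => /eqP.
by apply/factor_piP/xyI; rewrite ab subrr.
Qed.

Lemma correspondence_iso : ring_isomorphic (factor_pi I @` dom) cod.
Proof.
have pre (q : factor_ring I) : exists h, forall x a, rel x a -> factor_pi I x = q -> h = th a.
  have [[x [a [xa xq]]]|no] := pselect (exists x a, rel x a /\ factor_pi I x = q).
    by exists (th a) => y b yb yq; apply/(correspondence_eq xa yb); rewrite xq yq.
  by exists 0 => x a xa xq; case: no; exists x, a.
have [f fP] := choice pre.
have fE x a : rel x a -> f (factor_pi I x) = th a by move=> xa; exact: fP xa erefl.
have thD a b : th (a + b) = th a + th b.
  have th0 : th 0 = 0 by rewrite -(subrr 0) thB subrr.
  by rewrite -[b in LHS]opprK thB -[- b]sub0r thB th0 sub0r opprK.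
have relD x y a b : rel x a -> rel y b -> rel (x + y) (a + b).
  move=> xa yb; have yN := relB (relB yb yb) yb.
  by have := relB xa yN; rewrite !subrr !sub0r !opprK.
exists f; split.
- split.
  + by move=> _ [x [a xa] <-]; rewrite (fE _ _ xa); exists a => //; exists x.
  + move=> _ _ /set_mem[x [a xa] <-] /set_mem[y [b yb] <-].
    by rewrite (fE _ _ xa) (fE _ _ yb) => /(correspondence_eq xa yb).
  + move=> _ [a [x xa] <-]; exists (factor_pi I x); last exact: fE.
    by exists x => //; exists a.
- move=> _ _ [x [a xa] <-] [y [b yb] <-].
  by rewrite -factor_piD (fE _ _ xa) (fE _ _ yb) -thD; exact/fE/relD.
- move=> _ _ [x [a xa] <-] [y [b yb] <-].
  rewrite (fE _ _ xa) (fE _ _ yb) -thM -[LHS]/(f (factor_mul _ _)) -factor_piM.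
  exact/fE/relM.
Qed.

End Correspondence.

(** * The ring of uniform endomorphisms modulo the finitary ones *)

(** Compare [f] with the multiplication by [alpha], related to the same element
    of J. *)
Lemma periodic_uniform_by_finitary (Q : zmodType) (f : endo Q) alpha :
  periodic Q -> uniform_by f alpha ->
  f \in finitary Q <-> finite_set (range (@jact alpha Q)).
Proof.
move=> perQ fa; have [O OE] := exists_trivial Q.
have [m mE] := exists_multiplication perQ alpha.
have ma := multiplication_uniform_by perQ OE mE.
have freeO := trivial_free OE; have perO := trivial_periodic perQ OE.
apply: iff_trans (uniform_by_finitary fa freeO perO) _.
apply: iff_trans (iff_sym (uniform_by_finitary ma freeO perO)) _.
have -> : @jact alpha Q = m by apply/funext => x; rewrite mE.
by split=> [/asboolP|fin]; [|exact/asboolP].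
Qed.

Section Main.
Variable A : zmodType.
Hypothesis rankA : finite_torsionfree_rank A.

Lemma UI_uniform_by : UI A = [set f | exists alpha, uniform_by f alpha].
Proof. by apply/seteqP; split=> f /(uniformP f rankA). Qed.

Lemma uniform_by0 : uniform_by (0 : endo A) 0.
Proof. by apply: finitary_uniform_by; rewrite ?rpred0. Qed.

Lemma UI_subring : subring (UI A).
Proof.
rewrite UI_uniform_by; split.
- by exists 0; exact: uniform_by0.
- by move=> f g [a fa] [b gb]; exists (a - b); exact: uniform_byB.
- by move=> f g [a fa] [b gb]; exists (a * b); exact: uniform_byM.
Qed.

Lemma finitary_UI (f : endo A) : f \in finitary A -> UI A f.
Proof.
move=> ff; rewrite UI_uniform_by; exists 0; exact: finitary_uniform_by.
Qed.

Lemma UI_periodic : periodic A ->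
  UI A = finitary_multiplications A /\
  finitary_multiplications A
  = [set f + g | f in multiplications A & g in [set` finitary A]].
Proof.
move=> perA; have [O OE] := exists_trivial A.
have toM := @uniform_multiplication_finitary A perA O OE.
have toFM := @multiplication_finitary_FM A perA O OE.
have toU := @FM_uniform A perA O OE.
split; apply/seteqP; split=> f.
- by move=> /toM/toFM.
- exact: toU.
- by move=> /toU/toM.
- exact: toFM.
Qed.

End Main.

Section Isomorphisms.
Variables (A : zmodType) (F : zmodClosed A).
Hypothesis rankA : finite_torsionfree_rank A.
Hypotheses (freeF : free_abelian F) (perF : periodic {quot F}).

Definition UI_image : set (Hring F) :=
  [set theta F alpha | alpha in [set alpha | exists f : endo A, uniform_by f alpha]].

Lemma theta_finitary (f : endo A) alpha : uniform_by f alpha ->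
  f \in finitary A <-> theta F alpha = 0.
Proof.
move=> fa; apply: iff_trans (iff_sym (theta_eq0 perF alpha)).
apply: iff_trans (almost_acts0 F alpha).
exact: uniform_by_finitary fa (free_abelian_fg rankA freeF) perF.
Qed.

Lemma UI_mod_F_iso : subring UI_image /\ ring_isomorphic (UI_mod_F A) UI_image.
Proof.
split.
  apply: (correspondence_subring (@thetaB _ F) (@thetaM _ F) (@uniform_byB A) (@uniform_byM A)).
  by exists 0, 0; exact: uniform_by0.
rewrite /UI_mod_F UI_uniform_by//.
exact: (correspondence_iso (@thetaB _ F) (@thetaM _ F) (@uniform_byB A) (@uniform_byM A)
  theta_finitary).
Qed.

(** The group [Q] is [A] itself, if periodic, or the quotient A/F. On [Q] every
    element of J is related to a multiplication, whence surjectivity; the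
    hypothesis makes [theta F], rather than its analogue for [Q], detect the
    finitary endomorphisms. *)
Lemma UI_mod_F_periodic_iso (Q : zmodType) : periodic Q ->
    (forall alpha, finite_set (range (@jact alpha Q)) <->
       finite_set (range (@jact alpha {quot F}))) ->
  ring_isomorphic (UI_mod_F Q) [set: Hring F].
Proof.
move=> perQ finQ; have rankQ := periodic_rank perQ.
have relI (f : endo Q) alpha : uniform_by f alpha ->
    f \in finitary Q <-> theta F alpha = 0.
  move=> fa; apply: iff_trans (iff_sym (theta_eq0 perF alpha)).
  exact: iff_trans (periodic_uniform_by_finitary perQ fa) (finQ alpha).
have -> : [set: Hring F]
    = [set theta F alpha | alpha in [set alpha | exists f : endo Q, uniform_by f alpha]].
  apply/seteqP; split=> // h _; have [alpha <-] := theta_surj h.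
  exists alpha => //; have [O OE] := exists_trivial Q.
  have [m mE] := exists_multiplication perQ alpha.
  by exists m; have := multiplication_uniform_by perQ OE mE.
rewrite /UI_mod_F (UI_uniform_by rankQ).
exact: (correspondence_iso (@thetaB _ F) (@thetaM _ F) (@uniform_byB Q) (@uniform_byM Q) relI).
Qed.

Lemma finite_jact_quot alpha : periodic A ->
  finite_set (range (@jact alpha A)) <-> finite_set (range (@jact alpha {quot F})).
Proof.
move=> perA; have [O OE] := exists_trivial A.
have [m mE] := exists_multiplication perA alpha.
have ma := multiplication_uniform_by perA OE mE.
apply: iff_trans (iff_sym (periodic_uniform_by_finitary perA ma)) _.
apply: iff_trans (almost_acts0 F alpha).
exact: uniform_by_finitary ma (free_abelian_fg rankA freeF) perF.
Qed.

End Isomorphisms.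

Theorem proposition3 (A : zmodType) (rankA : finite_torsionfree_rank A) :
  [/\ subring (UI A),
      forall f : endo A, f \in finitary A -> UI A f,
      periodic A ->
        UI A = finitary_multiplications A /\
        finitary_multiplications A
        = [set f + g | f in multiplications A & g in [set` finitary A]]
    & forall F : zmodClosed A, free_abelian F -> periodic {quot F} ->
      [/\ exists S : set (Hring F),
            subring S /\ ring_isomorphic (UI_mod_F A) S,
          periodic A -> ring_isomorphic (UI_mod_F A) [set: Hring F]
        & exists K : zmodClosed A,
            periodic {quot K} /\
            ring_isomorphic (UI_mod_F {quot K}) [set: Hring F]]].
Proof.
split; [exact: UI_subring | exact: finitary_UI | exact: UI_periodic |].
move=> F freeF perF; split.
- by exists (@UI_image A F); exact: UI_mod_F_iso.
- move=> perA; apply: UI_mod_F_periodic_iso => // alpha.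
  exact: finite_jact_quot.
- by exists F; split=> //; apply: UI_mod_F_periodic_iso.
Qed.
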